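(* Let $p\ge 2$ be a constant. There is a constant $C_p$ (depending only on $p$) and a three-round algorithm in the coordinator model with $k$ sites which, given an accuracy parameter $\epsilon\in(0,1)$, for any noisy dataset $\sigma$ of $m$ items partitioned among the sites and any ground truth $\tau$ of $\sigma$ with $\eta_p(\sigma,\tau)\le\frac{\epsilon^p}{4^{p+1}k^{p-1}}$, outputs at the coordinator, with probability at least $0.99$, a value $\tilde F$ with $$(1-\epsilon - C_p\,\eta_p(\sigma,\tau))\,F_p(\tau) \le \tilde F \le (1+\epsilon + C_p\,\eta_p(\sigma,\tau))\,F_p(\tau),$$ using $O\!\left(\frac{k^p}{\epsilon^{p+1}}\right)$ words of communication.
   Context: Noisy-data framework. A noisy dataset is a sequence $\sigma=(\sigma_1,\ldots,\sigma_m)$ of items with a reflexive, symmetric (not necessarily transitive) similarity relation $\sim$ on items, accessible only via an oracle. A ground truth of $\sigma$ is a sequence $\tau\in U^m$ over a finite universe $U$, hidden from the algorithm; no relation between $\sim$ and $\tau$ is assumed. For $i\in[m]$, $B_i^\sigma=\{j:\sigma_j\sim\sigma_i\}$, $B_i^\tau=\{j:\tau_j=\tau_i\}$; $F_p(\tau)=\sum_{u\in U}|\{i:\tau_i=u\}|^p$; and $$\eta_p(\sigma,\tau)=\frac{1}{F_p(\tau)}\sum_{i\in[m]}\left(|B_i^\sigma\cup B_i^\tau|^{p-1}-|B_i^\sigma\cap B_i^\tau|^{p-1}\right).$$ Coordinator model: $k$ sites and a coordinator, items partitioned among the sites; in each round the coordinator sends a message to each site and each site replies; at the end the coordinator outputs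 the answer. Communication is measured in words, each item fitting in one word. *)

(* Defs.v *)
From HB Require Import structures.
From mathcomp Require Import all_boot all_order all_algebra.
From mathcomp Require Import all_classical all_reals all_analysis.
Set Implicit Arguments.
Unset Strict Implicit.
Unset Printing Implicit Defensive.
Import Order.TTheory GRing.Theory Num.Theory.
Local Open Scope ring_scope.

(** * Noisy data *)

Definition ball_noisy (T : Type) (sim : rel T) (m : nat) (sigma : m.-tuple T)
    (i : 'I_m) : {set 'I_m} :=
  [set j : 'I_m | sim (tnth sigma j) (tnth sigma i)]%SET.

Definition ball_truth (U : finType) (m : nat) (tau : m.-tuple U) (i : 'I_m) :
    {set 'I_m} :=
  [set j : 'I_m | tnth tau j == tnth tau i]%SET.

Definition freq_moment (R : realType) (p : R) (U : finType) (m : nat)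
    (tau : m.-tuple U) : R :=
  \sum_(u : U) #|[set i : 'I_m | tnth tau i == u]%SET|%:R `^ p.

(* The quantity eta_p; for m = 0 the sum and the frequency moment vanish, and
   it is 0. *)
Definition noise_level (R : realType) (p : R) (T : Type) (sim : rel T)
    (U : finType) (m : nat) (sigma : m.-tuple T) (tau : m.-tuple U) : R :=
  (freq_moment p tau)^-1 *
  \sum_(i < m)
    (#|ball_noisy sim sigma i :|: ball_truth tau i|%:R `^ (p - 1)
     - #|ball_noisy sim sigma i :&: ball_truth tau i|%:R `^ (p - 1)).

(** * Finitely supported distributions *)

(* A list of weighted outcomes; the same outcome may be listed several times. *)
Record dist (R : realType) (A : Type) := Dist {
  outcomes : seq (R * A);
  outcomes_ge0 : all (fun x => 0 <= x.1) outcomes;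
  outcomes_sum1 : \sum_(x <- outcomes) x.1 = 1 }.

Definition prob (R : realType) (A : Type) (d : dist R A) (E : A -> bool) : R :=
  \sum_(x <- outcomes d | E x.2) x.1.

Definition ret_outcomes (R : realType) (A : Type) (a : A) : seq (R * A) :=
  [:: (1, a)].

Lemma ret_ge0 (R : realType) (A : Type) (a : A) :
  all (fun x => 0 <= x.1) (ret_outcomes R a).
Proof. by rewrite /= ler01. Qed.

Lemma ret_sum1 (R : realType) (A : Type) (a : A) :
  \sum_(x <- ret_outcomes R a) x.1 = 1.
Proof. by rewrite big_seq1. Qed.

Definition dret (R : realType) (A : Type) (a : A) : dist R A :=
  Dist (ret_ge0 R a) (ret_sum1 R a).

Definition bind_outcomes (R : realType) (A B : Type) (d : dist R A)
    (f : A -> dist R B) : seq (R * B) :=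
  flatten [seq [seq (x.1 * y.1, y.2) | y <- outcomes (f x.2)]
          | x <- outcomes d].

Lemma bind_ge0 (R : realType) (A B : Type) (d : dist R A) (f : A -> dist R B) :
  all (fun x => 0 <= x.1) (bind_outcomes d f).
Proof.
rewrite /bind_outcomes; case: d => s /= + _.
elim: s => //= x s IH /andP[x0 /IH]; rewrite all_cat => ->; rewrite andbT.
rewrite all_map; have := outcomes_ge0 (f x.2).
by apply: sub_all => y /=; exact: mulr_ge0.
Qed.

Lemma bind_sum1 (R : realType) (A B : Type) (d : dist R A) (f : A -> dist R B) :
  \sum_(x <- bind_outcomes d f) x.1 = 1.
Proof.
rewrite big_flatten big_map -[RHS](outcomes_sum1 d); apply: eq_bigr => x _.
by rewrite big_map /= -mulr_sumr outcomes_sum1 mulr1.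
Qed.

Definition dbind (R : realType) (A B : Type) (d : dist R A)
    (f : A -> dist R B) : dist R B :=
  Dist (bind_ge0 d f) (bind_sum1 d f).

(* Independent draws. *)
Fixpoint dtuple (R : realType) (A : Type) (n : nat) :
    ('I_n -> dist R A) -> dist R (n.-tuple A) :=
  match n with
  | 0 => fun=> dret R [tuple]
  | n'.+1 => fun d =>
      dbind (d ord0) (fun a =>
      dbind (dtuple (fun i => d (lift ord0 i))) (fun t =>
      dret R [tuple of a :: t]))
  end.

(** * The coordinator model *)

(* Items are opaque to the parties: a party names an item by a handle, its
   position in the list of the items that the party holds.  A message as seen
   by a party is a sequence of words, each of them a number or a handle. *)
Inductive word := WNum of nat | WItem of nat.

Definition message := seq word.

(* What a party may base its decisions on: the answers of the similarity
   oracle on all pairs of items it holds, and the messages it has sent and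
   received so far, in chronological order.  All of a party's randomness is
   private, and is drawn afresh at each step. *)
Record view := View { oracle : seq (seq bool); past : seq message }.

Record protocol (R : realType) (k : nat) := Protocol {
  coord_send : view -> dist R (k.-tuple message);
  site_reply : 'I_k -> view -> dist R message;
  coord_output : view -> dist R R }.

Record party (T : Type) := Party { held : seq T; transcript : seq message }.

Definition view_of (T : Type) (sim : rel T) (P : party T) : view :=
  View [seq [seq sim x y | y <- held P] | x <- held P] (transcript P).

(* On the channel handles are replaced by the items they name; a handle that
   names no item is not transmitted. *)
Definition wire (T : Type) := seq (nat + T).

Definition to_wire (T : Type) (items : seq T) (msg : message) : wire T :=
  pmap (fun w => match w with
                 | WNum n => Some (inl n)
                 | WItem h => omap inr (onth items h)
                 end) msg.

(* Each item received gets a fresh handle, even if the receiver already holds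
   it. *)
Fixpoint of_wire (T : Type) (items : seq T) (w : wire T) :
    seq T * message :=
  match w with
  | [::] => (items, [::])
  | inl n :: w' =>
      let: (items', msg) := of_wire items w' in (items', WNum n :: msg)
  | inr x :: w' =>
      let: (items', msg) := of_wire (rcons items x) w' in
      (items', WItem (size items) :: msg)
  end.

Definition sent (T : Type) (P : party T) (msg : message) : party T :=
  Party (held P) (rcons (transcript P) msg).

Definition received (T : Type) (P : party T) (w : wire T) : party T :=
  let: (items, msg) := of_wire (held P) w in
  Party items (rcons (transcript P) msg).

(* [traffic] lists all the words transmitted so far, in both directions. *)
Record config (T : Type) (k : nat) := Config {
  coord : party T;
  sites : 'I_k -> party T;
  traffic : wire T }.

Definition init_config (T : Type) (k m : nat) (sigma : m.-tuple T)
    (place : 'I_m -> 'I_k) : config T k :=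
  Config (Party [::] [::])
    (fun j => Party [seq tnth sigma i | i <- enum 'I_m & place i == j] [::])
    [::].

Definition one_round (R : realType) (T : Type) (sim : rel T) (k : nat)
    (A : protocol R k) (c : config T k) : dist R (config T k) :=
  dbind (coord_send A (view_of sim (coord c))) (fun out =>
  let down j := to_wire (held (coord c)) (tnth out j) in
  let coord1 := foldl (@sent T) (coord c) out in
  let sites1 j := received (sites c j) (down j) in
  dbind (dtuple (fun j => site_reply A j (view_of sim (sites1 j)))) (fun rep =>
  let up j := to_wire (held (sites1 j)) (tnth rep j) in
  let coord2 := foldl (@received T) coord1 [seq up j | j <- enum 'I_k] in
  let sites2 j := sent (sites1 j) (tnth rep j) in
  dret R (Config coord2 sites2
    (traffic c ++ flatten [seq down j | j <- enum 'I_k]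
               ++ flatten [seq up j | j <- enum 'I_k])))).

Fixpoint rounds (R : realType) (T : Type) (sim : rel T) (k : nat)
    (A : protocol R k) (r : nat) (c : config T k) : dist R (config T k) :=
  match r with
  | 0 => dret R c
  | r'.+1 => dbind (one_round sim A c) (rounds sim A r')
  end.

(* The outcome of an execution with [r] rounds: everything that was
   transmitted, and the value output by the coordinator. *)
Definition execution (R : realType) (T : Type) (sim : rel T) (k : nat)
    (A : protocol R k) (r m : nat) (sigma : m.-tuple T)
    (place : 'I_m -> 'I_k) : dist R (wire T * R) :=
  dbind (rounds sim A r (init_config sigma place)) (fun c =>
  dbind (coord_output A (view_of sim (coord c))) (fun z =>
  dret R (traffic c, z))).

(* A word holds an item or a number of value at most m, so that numbers
   cannot be used to smuggle an unbounded amount of information. *)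
Definition fits_words (T : Type) (m : nat) (w : wire T) : bool :=
  all (fun x => if x is inl n then (n <= m)%N else true) w.

(* Main.v *)
Require Import Defs.
From HB Require Import structures.
From mathcomp Require Import all_boot all_order all_algebra.
From mathcomp Require Import all_classical all_reals all_analysis.
From mathcomp Require Import ring lra.
Set Implicit Arguments.
Unset Strict Implicit.
Unset Printing Implicit Defensive.
Import Order.TTheory GRing.Theory Num.Theory.
Local Open Scope ring_scope.

(** Writing [q = p - 1], the moment is the sum over the items of the [q]-th
    power of the size of their class, and up to the noise it is the sum of
    [b_i ^ q], where [b_i] is the number of items similar to item [i].  Each
    site samples its items with probability proportional to [o_i ^ q], where
    [o_i] counts the similar items on the same site, and an item with
    [b_i <= (16 k / eps) o_i] contributes [b_i ^ q / o_i ^ q] times a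
    normalization, so that the estimator has a small variance.  The items
    that violate this inequality are lost, but they hardly matter: either
    their true class is scattered thinly on their site, which concerns at most
    an [eps / 4] fraction of each class, or their ball differs from their
    class so much that the noise pays for them, and this is where the bound on
    [eta] is used.  Since [sum_i o_i ^ q] need not be an integer bounded by
    [m], a site announces the integer part [N] of its [p]-th root, and samples
    with the total mass [(2 N) ^ p] instead, the missing probability being
    given to an invalid handle that is never transmitted. *)

(** * Expectation and variance *)

Section FiniteProbability.
Variable R : realType.

Definition expect (A : Type) (d : dist R A) (f : A -> R) : R :=
  \sum_(x <- outcomes d) x.1 * f x.2.

(** Ranges over all listed outcomes, even those of weight zero, so that it passes through [dbind]
    without any positivity argument. *)
Definition surely (A : Type) (d : dist R A) (P : pred A) : bool :=
  all (fun x => P x.2) (outcomes d).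

Definition variance_of (A : Type) (d : dist R A) (f : A -> R) : R :=
  expect d (fun a => (f a - expect d f) ^+ 2).

Lemma expect_on (A : Type) (d : dist R A) (P : pred A) (f g : A -> R) :
  surely d P -> (forall a, P a -> f a = g a) -> expect d f = expect d g.
Proof.
rewrite /surely /expect => + H; elim: (outcomes d) => [|x s IH] /=.
  by rewrite !big_nil.
by move=> /andP[/H e /IH]; rewrite !big_cons e => ->.
Qed.

Lemma eq_expect (A : Type) (d : dist R A) (f g : A -> R) :
  f =1 g -> expect d f = expect d g.
Proof. by move=> e; apply: eq_bigr => x _; rewrite e. Qed.

Lemma le_expect (A : Type) (d : dist R A) (f g : A -> R) :
  (forall a, f a <= g a) -> expect d f <= expect d g.
Proof.
rewrite /expect => H; have := outcomes_ge0 d.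
elim: (outcomes d) => [|x s IH] /=; first by rewrite !big_nil.
by move=> /andP[x0 /IH]; rewrite !big_cons; apply: lerD; rewrite ler_wpM2l.
Qed.

Lemma expect_cst (A : Type) (d : dist R A) c : expect d (fun=> c) = c.
Proof. by rewrite /expect -mulr_suml outcomes_sum1 mul1r. Qed.

Lemma expectD (A : Type) (d : dist R A) (f g : A -> R) :
  expect d (fun a => f a + g a) = expect d f + expect d g.
Proof. by rewrite /expect -big_split; apply: eq_bigr => x _; rewrite mulrDr. Qed.

Lemma expectZ (A : Type) (d : dist R A) c (f : A -> R) :
  expect d (fun a => c * f a) = c * expect d f.
Proof. by rewrite /expect mulr_sumr; apply: eq_bigr => x _; rewrite mulrCA. Qed.

Lemma expect_dret (A : Type) (a : A) f : expect (dret R a) f = f a.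
Proof. by rewrite /expect big_seq1 mul1r. Qed.

Lemma expect_dbind (A B : Type) (d : dist R A) (k : A -> dist R B) f :
  expect (dbind d k) f = expect d (fun a => expect (k a) f).
Proof.
rewrite /expect big_flatten big_map; apply: eq_bigr => x _.
by rewrite big_map mulr_sumr; apply: eq_bigr => y _; rewrite mulrA.
Qed.

Lemma probE (A : Type) (d : dist R A) E : prob d E = expect d (fun a => (E a)%:R).
Proof.
rewrite /prob /expect big_mkcond; apply: eq_bigr => x _.
by case: (E _); rewrite ?mulr1 ?mulr0.
Qed.

Lemma surely_dret (A : Type) (a : A) (P : pred A) : P a -> surely (dret R a) P.
Proof. by rewrite /surely /= => ->. Qed.

Lemma surely_dbind (A B : Type) (d : dist R A) (k : A -> dist R B)
    (P : pred A) (Q : pred B) :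
  surely d P -> (forall a, P a -> surely (k a) Q) -> surely (dbind d k) Q.
Proof.
rewrite /surely /= /bind_outcomes => + H.
elim: (outcomes d) => [//|x s IH] /= /andP[/H Hx /IH]; rewrite all_cat => ->.
by rewrite andbT all_map.
Qed.

Lemma surelyT (A : Type) (d : dist R A) : surely d xpredT.
Proof. exact: all_predT. Qed.

Lemma surely_dtuple (A : Type) n (d : 'I_n -> dist R A) (P : 'I_n -> pred A) :
  (forall i, surely (d i) (P i)) ->
  surely (dtuple d) (fun t => [forall i, P i (tnth t i)]).
Proof.
elim: n d P => [|n IH] d P H /=.
  by apply: surely_dret; apply/forallP => -[].
apply: surely_dbind (H ord0) _ => a Pa.
apply: surely_dbind (IH _ (fun i => P (lift ord0 i)) _) _ => [i|t /forallP Pt].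
  exact: H.
apply: surely_dret; apply/forallP => i.
by case: (unliftP ord0 i) => [j|] ->; rewrite ?tnth0 // tnthS.
Qed.

Lemma expect_dtupleS (A : Type) n (d : 'I_n.+1 -> dist R A) f :
  expect (dtuple d) f =
  expect (d ord0) (fun a => expect (dtuple (fun i => d (lift ord0 i)))
    (fun t => f [tuple of a :: t])).
Proof.
rewrite /= expect_dbind; apply: eq_expect => a.
by rewrite expect_dbind; apply: eq_expect => t; rewrite expect_dret.
Qed.

Lemma expect_dtuple_dret (A : Type) n (a : 'I_n -> A) f :
  expect (dtuple (fun i => dret R (a i))) f = f [tuple a i | i < n].
Proof.
elim: n a f => [|n IH] a f.
  by rewrite expect_dret; congr f; rewrite [RHS]tuple0.
rewrite expect_dtupleS expect_dret (IH (fun i => a (lift ord0 i))).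
congr f; apply: eq_from_tnth => i.
by case: (unliftP ord0 i) => [j|] ->; rewrite ?tnth0 ?tnthS !tnth_mktuple.
Qed.

Lemma expect_dtuple_sum (A : Type) n (d : 'I_n -> dist R A) (f : 'I_n -> A -> R) :
  expect (dtuple d) (fun t => \sum_i f i (tnth t i)) = \sum_i expect (d i) (f i).
Proof.
elim: n d f => [|n IH] d f; first by rewrite expect_dret !big_ord0.
rewrite expect_dtupleS big_ord_recl -(IH _ (fun i => f (lift ord0 i))).
under eq_expect => a.
  under eq_expect => t.
    rewrite big_ord_recl tnth0.
    under eq_bigr do rewrite tnthS.
    over.
  rewrite expectD expect_cst; over.
by rewrite expectD expect_cst.
Qed.

Lemma variance_ofE (A : Type) (d : dist R A) f :
  variance_of d f = expect d (fun a => f a ^+ 2) - expect d f ^+ 2.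
Proof.
rewrite /variance_of; set e := expect d f.
under eq_expect => a.
  rewrite (_ : _ ^+ 2 = f a ^+ 2 + (- (e *+ 2) * f a + e ^+ 2)); last by ring.
  over.
rewrite expectD expectD expectZ expect_cst -/e; ring.
Qed.

Lemma variance_of_le (A : Type) (d : dist R A) f :
  variance_of d f <= expect d (fun a => f a ^+ 2).
Proof. by rewrite variance_ofE lerBlDr lerDl sqr_ge0. Qed.

(** Induction on [n]: once the first coordinate is split off, independence turns the cross term into
    [S *+ 2 * f ord0 a], whose mean cancels against the square of the total mean. *)
Lemma variance_dtuple_sum (A : Type) n (d : 'I_n -> dist R A) (f : 'I_n -> A -> R) :
  variance_of (dtuple d) (fun t => \sum_i f i (tnth t i)) =
  \sum_i variance_of (d i) (f i).
Proof.
rewrite variance_ofE expect_dtuple_sum.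
elim: n d f => [|n IH] d f.
  by rewrite expect_dret !big_ord0; ring.
rewrite expect_dtupleS [in RHS]big_ord_recl -(IH _ (fun i => f (lift ord0 i))).
set S := \sum_(i < n) expect _ _; rewrite big_ord_recl -/S.
set d' := fun i => d (lift ord0 i).
pose T (t : n.-tuple A) := \sum_i f (lift ord0 i) (tnth t i).
have ET : expect (dtuple d') T = S.
  exact: (expect_dtuple_sum d' (fun i => f (lift ord0 i))).
rewrite (@eq_expect _ _ _ (fun a => f ord0 a ^+ 2 + (S *+ 2 * f ord0 a +
    expect (dtuple d') (fun t => T t ^+ 2)))); last first.
  move=> a; rewrite (@eq_expect _ _ _ (fun t => f ord0 a ^+ 2 +
    ((f ord0 a *+ 2) * T t + T t ^+ 2))); last first.
    move=> t; rewrite big_ord_recl tnth0.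
    rewrite (eq_bigr (fun i => f (lift ord0 i) (tnth t i))) => [|i _].
      by rewrite -/(T t); ring.
    by rewrite tnthS.
  by rewrite expectD expectD expectZ expect_cst ET; ring.
rewrite expectD expectD expectZ expect_cst variance_ofE /T; ring.
Qed.

(** The bound is a product rather than a quotient so as to cover [a = 0], which occurs for an empty
    dataset. *)
Lemma chebyshev_dist (A : Type) (d : dist R A) f a c :
  0 <= a -> 0 <= c -> variance_of d f <= c * a ^+ 2 ->
  1 - c <= prob d (fun x => `|f x - expect d f| <= a).
Proof.
move=> a0 c0; rewrite /variance_of; set e := expect d f => vle.
rewrite probE lerBlDr.
suff : expect d (fun x => (~~ (`|f x - e| <= a))%:R) <= c.
  move=> h; rewrite -lerBlDl; apply: le_trans h.
  rewrite lerBlDl -expectD -[leLHS](expect_cst d); apply: le_expect => x.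
  by case: (_ <= a); rewrite /= ?addr0 ?add0r.
move: a0; rewrite le_eqVlt => /predU1P[a0|a0]; last first.
  rewrite -(@ler_pM2r _ (a ^+ 2)) ?exprn_gt0 //; apply: le_trans vle.
  rewrite mulrC -expectZ; apply: le_expect => x.
  case: (leP `|f x - e| a) => /= h; first by rewrite mulr0 sqr_ge0.
  by rewrite mulr1 -[leRHS]real_normK ?num_real // lerXn2r ?nnegrE // ltW.
(* With [a = 0] the variance vanishes, so every outcome of nonzero weight sits exactly at the
   mean. *)
move: vle; rewrite -a0 expr0n mulr0 => vle.
suff -> : expect d (fun x => (~~ (`|f x - e| <= 0))%:R) = 0 by [].
move: vle; rewrite /expect; move: (outcomes_ge0 d).
elim: (outcomes d) => [|x s IH] /=; first by rewrite !big_nil.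
move=> /andP[x0 s0]; rewrite !big_cons => h.
have hs : 0 <= \sum_(j <- s) j.1 * (f j.2 - e) ^+ 2.
  elim: s s0 {IH h} => [|y s IHs] /=; rewrite ?big_nil // big_cons.
  by move=> /andP[y0 /IHs]; apply: addr_ge0; rewrite mulr_ge0 ?sqr_ge0.
have hx : 0 <= x.1 * (f x.2 - e) ^+ 2 by rewrite mulr_ge0 ?sqr_ge0.
rewrite IH //; last by lra.
have /eqP : x.1 * (f x.2 - e) ^+ 2 = 0 by lra.
rewrite mulf_eq0 sqrf_eq0 => /orP[/eqP ->|/eqP ->]; first by rewrite mul0r addr0.
by rewrite normr0 lexx mulr0 addr0.
Qed.

End FiniteProbability.

(** * The protocol *)

Section Channel.
Variable T : Type.

Definition is_item (w : word) : bool := if w is WItem _ then true else false.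

Definition picked (s : seq T) (msg : message) : seq T :=
  pmap (fun w => if w is WItem h then onth s h else None) msg.

(** What a party holding [n] items sees when it receives the lists of [xss] one after the other:
    each list takes the next run of fresh handles. *)
Fixpoint handle_blocks (n : nat) (xss : seq (seq T)) : seq message :=
  if xss is xs :: xss' then
    map WItem (iota n (size xs)) :: handle_blocks (n + size xs) xss'
  else [::].

Lemma to_wire_nums (s : seq T) ns : to_wire s (map WNum ns) = map inl ns.
Proof. by elim: ns => //= n ns ->. Qed.

Lemma to_wire_items (s : seq T) msg :
  all is_item msg -> to_wire s msg = map inr (picked s msg).
Proof.
by elim: msg => //= -[//|h] msg IH /= /IH ->; case: (onth s h).
Qed.

Lemma picked_all (s : seq T) : picked s (map WItem (iota 0 (size s))) = s.
Proof.
suff H (r : seq T) : picked (r ++ s) (map WItem (iota (size r) (size s))) = s.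
  exact: (H [::]).
elim: s r => //= x s IH r.
have -> : onth (r ++ x :: s) (size r) = Some x by elim: r.
by congr cons; rewrite -cat_rcons -[_.+1](size_rcons r x) IH.
Qed.

Lemma of_wire_nums (s : seq T) ns : of_wire s (map inl ns) = (s, map WNum ns).
Proof. by elim: ns => //= n ns ->. Qed.

Lemma of_wire_items (s xs : seq T) :
  of_wire s (map inr xs) = (s ++ xs, map WItem (iota (size s) (size xs))).
Proof.
elim: xs s => [s|x xs IH s] /=; first by rewrite cats0.
by rewrite IH size_rcons cat_rcons.
Qed.

Lemma received_nums (P : party T) ns :
  received P (map inl ns) = Party (held P) (rcons (transcript P) (map WNum ns)).
Proof. by rewrite /received of_wire_nums. Qed.

Lemma received_items (P : party T) xs :
  received P (map inr xs) =
  Party (held P ++ xs)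
    (rcons (transcript P) (map WItem (iota (size (held P)) (size xs)))).
Proof. by rewrite /received of_wire_items. Qed.

Lemma foldl_sent (P : party T) msgs :
  foldl (@sent T) P msgs = Party (held P) (transcript P ++ msgs).
Proof.
elim: msgs P => [P|msg msgs IH P] /=; first by rewrite cats0; case: P.
by rewrite IH /= cat_rcons.
Qed.

Lemma foldl_received_nums (P : party T) (nss : seq (seq nat)) :
  foldl (@received T) P (map (map inl) nss) =
  Party (held P) (transcript P ++ map (map WNum) nss).
Proof.
elim: nss P => [P|ns nss IH P] /=; first by rewrite cats0; case: P.
by rewrite received_nums IH /= cat_rcons.
Qed.

Lemma foldl_received_items (P : party T) (xss : seq (seq T)) :
  foldl (@received T) P (map (map inr) xss) =
  Party (held P ++ flatten xss)
    (transcript P ++ handle_blocks (size (held P)) xss).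
Proof.
elim: xss P => [P|xs xss IH P] /=; first by rewrite !cats0; case: P.
by rewrite received_items IH /= cat_rcons size_cat catA.
Qed.

Lemma size_handle_blocks n (xss : seq (seq T)) :
  size (handle_blocks n xss) = size xss.
Proof. by elim: xss n => //= xs xss IH n; rewrite IH. Qed.

(** Turns the coordinator's sum over its own handles into a sum over the sampled items. The prefix
    [pre] is the part already received, over which the induction on blocks generalizes. *)
Lemma sum_handle_blocks (V : nmodType) (pre : seq T) (xss : seq (seq T)) j
    (phi : word -> V) (psi : T -> V) :
  (forall h x, onth (pre ++ flatten xss) h = Some x -> phi (WItem h) = psi x) ->
  \sum_(w <- nth [::] (handle_blocks (size pre) xss) j) phi w =
  \sum_(x <- nth [::] xss j) psi x.
Proof.
elim: xss j pre => [j pre _|xs xss IH [|j] pre] /=.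
- by rewrite !nth_nil !big_nil.
- elim: xs pre => [pre _|x xs IHx pre H] /=; first by rewrite !big_nil.
  rewrite !big_cons; congr (_ + _).
    by apply: H; elim: pre.
  rewrite -[_.+1](size_rcons pre x) IHx // => h y; rewrite cat_rcons.
  exact: H.
- by rewrite catA -size_cat; exact: IH.
Qed.

End Channel.

(** * The sampling protocol and its constants *)

Section Protocol.
Variables (R : realType) (p : R) (k : nat) (eps : R).

Definition row_degree (o : seq (seq bool)) (h : nat) : nat :=
  count id (nth [::] o h).

Definition local_moment (o : seq (seq bool)) : R :=
  \sum_(h < size o) (row_degree o h)%:R `^ (p - 1).

Definition root_moment (o : seq (seq bool)) : nat :=
  Num.truncn (local_moment o `^ p^-1).

Definition mass (N : nat) : R := (2 * N%:R) `^ p.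

(** Makes the draw a distribution for every list of weights; on the weights that the sites really
    use, clipping changes nothing. *)
Definition clipped (w : seq R) : seq R :=
  if all (fun x => 0 <= x) w && (\sum_(x <- w) x <= 1) then w else [::].

(* The index [size w], which names no item, takes the weight missing from
   [w]. *)
Definition index_outcomes (w : seq R) : seq (R * nat) :=
  (1 - \sum_(x <- clipped w) x, size w) ::
  [seq (nth 0 (clipped w) h, h) | h <- iota 0 (size (clipped w))].

Lemma clipped_ge0 w : all (fun x => 0 <= x) (clipped w).
Proof. by rewrite /clipped; case: ifP => // /andP[]. Qed.

Lemma clipped_sum_le1 w : \sum_(x <- clipped w) x <= 1.
Proof. by rewrite /clipped; case: ifP => [/andP[]//|]; rewrite big_nil. Qed.

Lemma index_outcomes_ge0 w : all (fun x => 0 <= x.1) (index_outcomes w).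
Proof.
rewrite /= subr_ge0 clipped_sum_le1 all_map; apply/allP => h /=.
by rewrite mem_iota => /andP[_ hlt]; apply: (allP (clipped_ge0 w)); rewrite mem_nth.
Qed.

Lemma index_outcomes_sum1 w : \sum_(x <- index_outcomes w) x.1 = 1.
Proof.
rewrite big_cons big_map /= [X in _ + X](_ : _ = \sum_(x <- clipped w) x) ?subrK //.
by rewrite [RHS](big_nth 0) /index_iota subn0.
Qed.

Definition draw_index (w : seq R) : dist R nat :=
  Dist (index_outcomes_ge0 w) (index_outcomes_sum1 w).

Definition sampling_weights (o : seq (seq bool)) : seq R :=
  [seq (row_degree o h)%:R `^ (p - 1) / mass (root_moment o) | h <- iota 0 (size o)].

Definition site_sample (o : seq (seq bool)) (n : nat) : dist R message :=
  dbind (dtuple (fun _ : 'I_n => draw_index (sampling_weights o)))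
    (fun t => dret R (map WItem t)).

(** The factor [2 ^ p] pays for the rounding in [mass], and [(16 k / eps) ^ (p - 1)] bounds the
    reweighting of a kept item. The remaining [1600 / eps ^ 2] comes from Chebyshev: [100] for the
    failure probability, [4] for a deviation of half of [eps], and [4] because the noisy moment may
    be twice the true one. *)
Definition sample_size : R :=
  1600 * 2 `^ p * 16 `^ (p - 1) * k%:R `^ (p - 1) / eps `^ (p + 1).

(** A share proportional to the mass, rounded strictly up, so that it is never zero and can be
    divided by. *)
Definition draws (N : 'I_k -> nat) (j : 'I_k) : nat :=
  (Num.truncn (sample_size * mass (N j) / \sum_i mass (N i))).+1.

(** The cutoff bounds the ratio [tot / own] by [16 k / eps], which controls the variance; its only
    cost is that some items are lost. *)
Definition rescaled (own tot : nat) : R :=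
  if eps * tot%:R <= 16 * k%:R * own%:R
  then (tot%:R / own%:R) `^ (p - 1) else 0.

(** Every half round adds [k] messages to the coordinator's transcript. The blocks [a] are: 0 empty
    messages, 1 announced roots, 2 requests, 3 samples, 4 broadcast of all samples, 5 counts. *)
Definition coord_past (v : view) (a : nat) (j : 'I_k) : message :=
  nth [::] (past v) (a * k + j).

Definition num_word (w : word) : nat := if w is WNum n then n else 0.

Definition reported (v : view) (j : 'I_k) : nat :=
  num_word (head (WNum 0) (coord_past v 1 j)).

Definition count_of (v : view) (j : 'I_k) (h : nat) : nat :=
  num_word (nth (WNum 0) (coord_past v 5 j) h).

(* The requested number of samples is sent in unary, since it may exceed m. *)
Definition request (v : view) : k.-tuple message :=
  if size (past v) == (2 * k)%N then
    [tuple map WNum (nseq (draws (reported v) j) 0) | j < k]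
  else if size (past v) == (4 * k)%N then
    [tuple map WItem (iota 0 (size (oracle v))) | j < k]
  else [tuple [::] | j < k].

(** The broadcast samples have the last handles. Their rows are cut to the [old] columns, so that
    copies of samples are not counted among the items of the site. *)
Definition site_counts (v : view) : message :=
  let fresh := size (nth [::] (past v) 4) in
  let old := (size (oracle v) - fresh)%N in
  map WNum [seq count id (take old row) | row <- drop old (oracle v)].

(** The round is read off the length of the transcript, which already includes the message just
    received. *)
Definition reply (v : view) : dist R message :=
  if size (past v) == 1%N then dret R [:: WNum (root_moment (oracle v))]
  else if size (past v) == 3%N then
    site_sample (oracle v) (size (nth [::] (past v) 2))
  else dret R (site_counts v).

(** An importance sampling (Hansen-Hurwitz) estimator: the mass per draw and the rescaling together
    invert the sampling weights. *)
Definition estimate (v : view) : R :=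
  \sum_j \sum_(w <- coord_past v 3 j)
    if w is WItem h then
      mass (reported v j) / (draws (reported v) j)%:R *
      rescaled (count_of v j h) (\sum_i count_of v i h)
    else 0.

Definition sampling_protocol : protocol R k :=
  Protocol (fun v => dret R (request v)) (fun _ v => reply v)
    (fun v => dret R (estimate v)).

End Protocol.

(** * The execution *)

Lemma expect_one_round (R : realType) (T : Type) (sim : rel T) k
    (A : protocol R k) (c : config T k) f :
  expect (one_round sim A c) f =
  expect (coord_send A (view_of sim (Defs.coord c))) (fun out =>
  let down j := to_wire (held (Defs.coord c)) (tnth out j) in
  let sites1 j := received (sites c j) (down j) in
  expect (dtuple (fun j => site_reply A j (view_of sim (sites1 j)))) (fun rep =>
  let up j := to_wire (held (sites1 j)) (tnth rep j) in
  f (Config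
    (foldl (@received T) (foldl (@sent T) (Defs.coord c) out)
       [seq up j | j <- enum 'I_k])
    (fun j => sent (sites1 j) (tnth rep j))
    (traffic c ++ flatten [seq down j | j <- enum 'I_k]
               ++ flatten [seq up j | j <- enum 'I_k])))).
Proof.
rewrite /one_round expect_dbind; apply: eq_expect => out.
rewrite expect_dbind; apply: eq_expect => rep.
by rewrite expect_dret.
Qed.

Lemma expect_dtuple_is_dret (R : realType) (A : Type) n (d : 'I_n -> dist R A)
    (a : 'I_n -> A) f :
  (forall i, d i = dret R (a i)) -> expect (dtuple d) f = f [tuple a i | i < n].
Proof. by move=> /funext ->; exact: expect_dtuple_dret. Qed.

Lemma nth_flatten_blocks (A : Type) (x0 : A) k (bs : seq (seq A)) a (j : 'I_k) :
  all (fun b => size b == k) bs ->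
  nth x0 (flatten bs) (a * k + j) = nth x0 (nth [::] bs a) j.
Proof.
elim: bs a => [a _|b bs IH [|a] /= /andP[/eqP bk bsk]] /=.
- by rewrite !nth_nil.
- by rewrite mul0n nth_cat bk ltn_ord.
- by rewrite mulSn -addnA nth_cat bk ltnNge leq_addr /= addKn IH.
Qed.

Section Execution.
Variables (R : realType) (p : R) (k : nat) (eps : R).
Hypothesis k_gt0 : (0 < k)%N.
Variables (T : Type) (sim : rel T) (m : nat) (sigma : m.-tuple T).
Variable place : 'I_m -> 'I_k.

Definition site_items (j : 'I_k) : seq T :=
  [seq tnth sigma i | i <- enum 'I_m & place i == j].

Definition site_oracle (j : 'I_k) : seq (seq bool) :=
  [seq [seq sim x y | y <- site_items j] | x <- site_items j].

Definition site_root (j : 'I_k) : nat := root_moment p (site_oracle j).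

Definition site_draws (j : 'I_k) : nat := draws p eps site_root j.

Definition site_count (j : 'I_k) (x : T) : nat := count (sim x) (site_items j).

Definition gain (j : 'I_k) (w : word) : R :=
  if w is WItem h then
    if onth (site_items j) h is Some x then
      mass p (site_root j) / (site_draws j)%:R *
      rescaled p k eps (site_count j x) (\sum_i site_count i x)
    else 0
  else 0.

Definition samples (rep : k.-tuple message) : seq T :=
  flatten [seq picked (site_items j) (tnth rep j) | j <- enum 'I_k].

Definition total_traffic (rep : k.-tuple message) : wire T :=
  map inl ([seq site_root j | j <- enum 'I_k] ++
           flatten [seq nseq (site_draws j) 0%N | j <- enum 'I_k]) ++
  map inr (samples rep) ++
  flatten [seq map inr (samples rep) | j <- enum 'I_k] ++
  flatten [seq map inl [seq site_count j x | x <- samples rep] | j <- enum 'I_k].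

Let A := sampling_protocol p k eps.

Let transcript1 : seq message :=
  [seq [::] | j <- enum 'I_k] ++ [seq [:: WNum (site_root j)] | j <- enum 'I_k].

Let requests : seq message :=
  [seq map WNum (nseq (site_draws j) 0%N) | j <- enum 'I_k].

Let config1 : config T k :=
  Config (Party [::] transcript1)
    (fun j => Party (site_items j) [:: [::]; [:: WNum (site_root j)]])
    (map inl [seq site_root j | j <- enum 'I_k]).

Lemma flatten_nil (I B : Type) (s : seq I) :
  flatten [seq [::] | _ <- s] = [::] :> seq B.
Proof. by elim: s. Qed.

Lemma size_ord_map (B : Type) (F : 'I_k -> B) : size [seq F j | j <- enum 'I_k] = k.
Proof. by rewrite size_map -cardE card_ord. Qed.

Lemma nth_ord_map (B : Type) (x0 : B) (F : 'I_k -> B) (j : 'I_k) :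
  nth x0 [seq F i | i <- enum 'I_k] j = F j.
Proof.
by rewrite (nth_map j) -?cardE ?card_ord ?ltn_ord // nth_ord_enum.
Qed.

Lemma flatten_map_inl (F : 'I_k -> seq nat) s :
  flatten [seq map inl (F j) | j <- s] =
  map inl (flatten [seq F j | j <- s]) :> wire T.
Proof. by elim: s => //= j s ->; rewrite map_cat. Qed.

Lemma flatten_map_inr (F : 'I_k -> seq T) s :
  flatten [seq map inr (F j) | j <- s] =
  map inr (flatten [seq F j | j <- s]) :> wire T.
Proof. by elim: s => //= j s ->; rewrite map_cat. Qed.

Lemma expect_round1 f :
  expect (one_round sim A (init_config sigma place)) f = f config1.
Proof.
rewrite expect_one_round expect_dret /=.
have e0 : request p k eps (View [::] [::]) = [tuple [::] | j < k].
  (* The tests on the transcript length tell the rounds apart because [k] is positive. *)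
  by rewrite /request /= !(eq_sym 0%N) !muln_eq0 /= (gtn_eqF k_gt0).
rewrite /view_of /= e0.
rewrite (@expect_dtuple_is_dret _ _ _ _ (fun j => [:: WNum (site_root j)])); last first.
  by move=> j; rewrite tnth_mktuple.
congr f; rewrite /config1; congr Config.
- rewrite foldl_sent /=.
  rewrite (_ : [seq _ | j <- _] = map (map inl) [seq [:: site_root j] | j <- enum 'I_k]).
    by rewrite foldl_received_nums /= -map_comp.
  by rewrite -map_comp; apply: eq_map => j; rewrite !tnth_mktuple.
- by apply/funext => j; rewrite !tnth_mktuple.
- rewrite (_ : flatten _ = [::]); last first.
    rewrite -[RHS](flatten_nil (nat + T) (enum 'I_k)); congr flatten.
    by apply: eq_map => j; rewrite tnth_mktuple.
  rewrite /= (_ : [seq _ | j <- enum 'I_k] =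
      [seq map inl [:: site_root j] | j <- enum 'I_k]).
    rewrite flatten_map_inl; congr map.
    by elim: (enum 'I_k) => //= j s ->.
  by apply: eq_map => j; rewrite !tnth_mktuple.
Qed.

Let blocks (rep : k.-tuple message) : seq (seq T) :=
  [seq picked (site_items j) (tnth rep j) | j <- enum 'I_k].

Let transcript2 (rep : k.-tuple message) : seq message :=
  transcript1 ++ requests ++ handle_blocks 0 (blocks rep).

Let config2 (rep : k.-tuple message) : config T k :=
  Config (Party (samples rep) (transcript2 rep))
    (fun j => Party (site_items j)
       [:: [::]; [:: WNum (site_root j)]; map WNum (nseq (site_draws j) 0%N);
           tnth rep j])
    (map inl ([seq site_root j | j <- enum 'I_k] ++
              flatten [seq nseq (site_draws j) 0%N | j <- enum 'I_k]) ++
     map inr (samples rep)).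

Lemma surely_site_sample o n :
  surely (site_sample p o n) (fun msg => all is_item msg && (size msg == n)).
Proof.
apply: surely_dbind (surelyT _) _ => t _; apply: surely_dret.
by rewrite size_map size_tuple eqxx andbT all_map; apply/allP.
Qed.

(** The only random round. Replies consist of handles only, so what travels is exactly the items
    that the valid handles name. *)
Lemma expect_round2 f :
  expect (one_round sim A config1) f =
  expect (dtuple (fun j => site_sample p (site_oracle j) (site_draws j)))
    (fun rep => f (config2 rep)).
Proof.
rewrite expect_one_round expect_dret /=.
have size1 : size transcript1 = (2 * k)%N.
  by rewrite /transcript1 size_cat !size_ord_map mul2n addnn.
have req1 : request p k eps (View [::] transcript1) =
    [tuple map WNum (nseq (site_draws j) 0%N) | j < k].
  rewrite /request /= size1 eqxx; apply: eq_from_tnth => j.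
  rewrite !tnth_mktuple /site_draws; congr (map _ (nseq (draws _ _ _ _) _)).
  apply/funext => i; rewrite /reported /coord_past /=.
  rewrite (_ : transcript1 = flatten [:: [seq [::] | j <- enum 'I_k];
    [seq [:: WNum (site_root j)] | j <- enum 'I_k]]); last by rewrite /= cats0.
  by rewrite nth_flatten_blocks /= ?size_ord_map ?eqxx // nth_ord_map.
rewrite /view_of /= req1.
have down j : to_wire [::] (tnth [tuple map WNum (nseq (site_draws j) 0%N) | j < k] j) =
    map inl (nseq (site_draws j) 0%N) :> wire T.
  by rewrite !tnth_mktuple to_wire_nums.
rewrite [X in dtuple X](_ : _ =
    (fun j => site_sample p (site_oracle j) (site_draws j))); last first.
  by apply/funext => j; rewrite down received_nums /reply /= size_map size_nseq.
apply: expect_on (surely_dtuple (fun j => surely_site_sample _ _)) _ => rep.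
move=> /forallP rep_items; congr f; rewrite /config2; congr Config.
- rewrite foldl_sent /=.
  rewrite (_ : [seq _ | j <- enum 'I_k] = map (map inr) (blocks rep)).
    by rewrite foldl_received_items /transcript2 /= catA.
  rewrite /blocks -map_comp; apply: eq_map => j /=.
  rewrite down received_nums /= to_wire_items //.
  by have /andP[] := rep_items j.
- by apply/funext => j; rewrite down received_nums.
- rewrite map_cat -!catA; congr (_ ++ _).
  rewrite -flatten_map_inl -flatten_map_inr; congr (flatten _ ++ flatten _).
    exact: eq_map.
  apply: eq_map => j; rewrite down received_nums /=.
  by rewrite to_wire_items //; have /andP[] := rep_items j.
Qed.

Let transcript3 (rep : k.-tuple message) : seq message :=
  transcript2 rep ++ [seq map WItem (iota 0 (size (samples rep))) | j <- enum 'I_k] ++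
  [seq map WNum [seq site_count j x | x <- samples rep] | j <- enum 'I_k].

Let config3 (rep : k.-tuple message) : config T k :=
  Config (Party (samples rep) (transcript3 rep))
    (fun j => Party (site_items j ++ samples rep)
       [:: [::]; [:: WNum (site_root j)]; map WNum (nseq (site_draws j) 0%N);
           tnth rep j; map WItem (iota (size (site_items j)) (size (samples rep)));
           map WNum [seq site_count j x | x <- samples rep]])
    (total_traffic rep).

Lemma site_countsE (s xs : seq T) past :
  size (nth [::] past 4) = size xs ->
  site_counts (View [seq [seq sim x y | y <- s ++ xs] | x <- s ++ xs] past) =
  map WNum [seq count (sim x) s | x <- xs].
Proof.
rewrite /site_counts /= => ->; rewrite size_map size_cat addnK; congr map.
rewrite map_cat drop_size_cat ?size_map // -map_comp; apply: eq_map => x /=.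
by rewrite map_cat take_size_cat ?size_map // count_map.
Qed.

Lemma expect_round3 rep f :
  expect (one_round sim A (config2 rep)) f = f (config3 rep).
Proof.
rewrite expect_one_round expect_dret /=.
have size2 : size (transcript2 rep) = (4 * k)%N.
  rewrite /transcript2 /transcript1 /requests !size_cat size_handle_blocks.
  by rewrite !size_ord_map; ring.
have req2 : request p k eps
      (View [seq [seq sim x y | y <- samples rep] | x <- samples rep] (transcript2 rep)) =
    [tuple map WItem (iota 0 (size (samples rep))) | j < k].
  rewrite /request /= size2 eqn_pmul2r //= eqxx size_map.
  by [].
rewrite /view_of /= req2.
have down j : to_wire (samples rep)
    (tnth [tuple map WItem (iota 0 (size (samples rep))) | _ < k] j) =
    map inr (samples rep).
  by rewrite tnth_mktuple to_wire_items ?picked_all // all_map; apply/allP.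
rewrite (@expect_dtuple_is_dret _ _ _ _
  (fun j => map WNum [seq site_count j x | x <- samples rep])); last first.
  move=> j; rewrite down received_items /= /reply /= site_countsE //=.
  by rewrite size_map size_iota.
congr f; rewrite /config3; congr Config.
- rewrite foldl_sent /=.
  rewrite (_ : [seq to_wire _ _ | j <- enum 'I_k] =
    map (map inl) [seq [seq site_count j x | x <- samples rep] | j <- enum 'I_k]).
    by rewrite foldl_received_nums /transcript3 /= -catA -map_comp.
  rewrite -[RHS]map_comp; apply: eq_map => j.
  by rewrite !tnth_mktuple to_wire_nums.
- by apply/funext => j; rewrite down received_items tnth_mktuple.
- rewrite /total_traffic -!catA; do 2 congr (_ ++ _).
  congr (flatten _ ++ flatten _); apply: eq_map => j; first exact: down.
  by rewrite !tnth_mktuple to_wire_nums.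
Qed.

Lemma onth_map_nth (B C : Type) (g : B -> C) (s : seq B) (y0 : C) h x :
  onth s h = Some x -> nth y0 (map g s) h = g x.
Proof. by elim: s h => [|y s IH] [|h] //= => [[->]|/IH]. Qed.

(** The transcript consists of six blocks of [k] messages, from which the coordinator recovers the
    true roots and counts; its output is thus a sum of per-draw gains independent across sites. *)
Lemma estimateE rep :
  estimate p k eps (view_of sim (Party (samples rep) (transcript3 rep))) =
  \sum_j \sum_(w <- tnth rep j) gain j w.
Proof.
rewrite /estimate /view_of /=.
set v := View _ _.
have pastE : past v = flatten [:: [seq [::] | j <- enum 'I_k];
    [seq [:: WNum (site_root j)] | j <- enum 'I_k]; requests;
    handle_blocks 0 (blocks rep);
    [seq map WItem (iota 0 (size (samples rep))) | j <- enum 'I_k];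
    [seq map WNum [seq site_count j x | x <- samples rep] | j <- enum 'I_k]].
  by rewrite /= /transcript3 /transcript2 /transcript1 cats0 -!catA.
have coordE a (j : 'I_k) : coord_past v a j =
    nth [::] (nth [::] [:: [seq [::] | j <- enum 'I_k];
    [seq [:: WNum (site_root j)] | j <- enum 'I_k]; requests;
    handle_blocks 0 (blocks rep);
    [seq map WItem (iota 0 (size (samples rep))) | j <- enum 'I_k];
    [seq map WNum [seq site_count j x | x <- samples rep] | j <- enum 'I_k]] a) j.
  rewrite /coord_past pastE nth_flatten_blocks //.
  by rewrite /= size_handle_blocks /requests /blocks !size_ord_map !eqxx.
have repE : reported v = site_root.
  by apply/funext => j; rewrite /reported coordE /= nth_ord_map.
have cntE j h x : onth (samples rep) h = Some x -> count_of v j h = site_count j x.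
  move=> hx; rewrite /count_of coordE /= nth_ord_map -map_comp.
  by rewrite (onth_map_nth _ _ hx).
rewrite repE; apply: eq_bigr => j _; rewrite coordE /=.
rewrite (@sum_handle_blocks _ _ [::] _ _ _ (fun x =>
      mass p (site_root j) / (site_draws j)%:R *
      rescaled p k eps (site_count j x) (\sum_i site_count i x)%N)); last first.
  move=> h x hx; rewrite (cntE _ _ x) //.
  by under eq_bigr do rewrite (cntE _ _ x) //.
(* Words dropped by [picked], such as the invalid handle, have gain zero. *)
rewrite nth_ord_map /picked; elim: (tnth rep j) => [|w msg IH] /=.
  by rewrite !big_nil.
rewrite big_cons -IH; case: w => [n|h] /=; first by rewrite add0r.
by case: (onth _ h) => [x|] /=; rewrite ?big_cons ?add0r.
Qed.

(** Reduces the whole execution to independent samples at the sites; everything else is a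
    deterministic function of them. *)
Lemma expect_execution f :
  expect (execution sim A 3 sigma place) f =
  expect (dtuple (fun j => site_sample p (site_oracle j) (site_draws j)))
    (fun rep => f (total_traffic rep, \sum_j \sum_(w <- tnth rep j) gain j w)).
Proof.
rewrite expect_dbind /= expect_dbind expect_round1 expect_dbind expect_round2.
apply: eq_expect => rep; rewrite expect_dbind expect_round3 expect_dret.
by rewrite expect_dbind expect_dret expect_dret /= estimateE.
Qed.

End Execution.

(** * Noise *)

Section Noise.
Variables (R : realType) (p : R).
Hypothesis p_ge2 : 2 <= p.
Variables (T : Type) (sim : rel T) (m : nat) (sigma : m.-tuple T).
Variables (U : finType) (tau : m.-tuple U).
Variables (k : nat) (place : 'I_m -> 'I_k).
Hypothesis k_gt0 : (0 < k)%N.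

Local Notation q := (p - 1).
Let q_ge1 : 1 <= q. Proof. by move: p_ge2; lra. Qed.
Let q_ge0 : 0 <= q. Proof. exact: le_trans ler01 q_ge1. Qed.

Local Notation B := (ball_noisy sim sigma).
Local Notation Bt := (ball_truth tau).

Definition same_site (i : 'I_m) : {set 'I_m} := [set j | place j == place i]%SET.

Definition noise_at (i : 'I_m) : R :=
  #|B i :|: Bt i|%:R `^ q - #|B i :&: Bt i|%:R `^ q.

(** The test of [rescaled], written with balls instead of counts. *)
Definition kept (eps : R) (i : 'I_m) : bool :=
  eps * #|B i|%:R <= 16 * k%:R * #|B i :&: same_site i|%:R.

Lemma powR_le (x y : R) : 0 <= x -> x <= y -> x `^ q <= y `^ q.
Proof.
by move=> x0 xy; apply: ge0_ler_powR; rewrite // nnegrE // (le_trans x0).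
Qed.

Lemma powR_card_le (E F : {set 'I_m}) :
  E \subset F -> #|E|%:R `^ q <= #|F|%:R `^ q :> R.
Proof. by move=> EF; rewrite powR_le // ler_nat subset_leq_card. Qed.

Lemma card_ball_truth_gt0 i : (0 < #|Bt i|)%N.
Proof. by apply/card_gt0P; exists i; rewrite inE. Qed.

Lemma sum_classes (G : U -> R) :
  \sum_i G (tnth tau i) =
  \sum_u #|[set i | tnth tau i == u]%SET|%:R * G u.
Proof.
rewrite (partition_big (tnth tau) xpredT) //=; apply: eq_bigr => u _.
rewrite (eq_bigr (fun=> G u)) => [|i /eqP -> //].
by rewrite sumr_const mulr_natl; congr (_ *+ _); apply: eq_card => i; rewrite !inE.
Qed.

Lemma freq_momentE : freq_moment p tau = \sum_i #|Bt i|%:R `^ q.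
Proof.
pose G u : R := #|[set i | tnth tau i == u]%SET|%:R `^ q.
transitivity (\sum_i G (tnth tau i)); last exact: eq_bigr.
rewrite sum_classes; apply: eq_bigr => u _; rewrite mulr_powRB1 //; move: p_ge2; lra.
Qed.

Lemma freq_moment_ge0 : 0 <= freq_moment p tau.
Proof. by apply: sumr_ge0 => u _; exact: powR_ge0. Qed.

Lemma sum_noise : \sum_i noise_at i = noise_level p sim sigma tau * freq_moment p tau.
Proof.
rewrite /noise_level mulrAC; have [F0|F0] := eqVneq (freq_moment p tau) 0.
  (* A zero moment leaves no items, since each one would contribute a positive power of its class
     size. *)
  rewrite F0 mulr0 mul0r big1 // => i _; exfalso.
  move: F0; rewrite freq_momentE => /eqP; rewrite psumr_eq0 => [|j _]; last exact: powR_ge0.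
  move=> /allP /(_ i); rewrite mem_index_enum => /(_ isT) /=.
  by rewrite powR_eq0 pnatr_eq0 -leqn0 leqNgt card_ball_truth_gt0.
by rewrite mulVf // mul1r.
Qed.

Lemma noise_at_ge0 i : 0 <= noise_at i.
Proof.
rewrite subr_ge0; apply: powR_card_le.
exact: fintype.subset_trans (finset.subsetIl _ _) (finset.subsetUl _ _).
Qed.

Lemma noise_level_ge0 : 0 <= noise_level p sim sigma tau.
Proof.
rewrite /noise_level mulr_ge0 ?invr_ge0 ?freq_moment_ge0 //.
by apply: sumr_ge0 => i _; exact: noise_at_ge0.
Qed.

(** Pass from the ball to its union with the class; the excess over the intersection is the noise,
    and the intersection lies in the class. *)
Lemma noisy_moment_le :
  \sum_i #|B i|%:R `^ q <= (1 + noise_level p sim sigma tau) * freq_moment p tau.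
Proof.
rewrite mulrDl mul1r -sum_noise freq_momentE -big_split; apply: ler_sum => i _.
rewrite /noise_at /= addrCA -[leLHS]addr0 lerD ?powR_card_le ?finset.subsetUl //.
by rewrite subr_ge0 powR_card_le // finset.subsetIr.
Qed.

(** If a class of size [c] is scattered on a site, that site holds fewer than [eps c / (4 k)] of its
    items. Over [k] sites this is at most an [eps / 4] fraction of the class, and each item weighs
    [c ^ (p - 1)]. *)
Lemma scattered_moment_le (eps : R) : 0 <= eps ->
  \sum_(i | 4 * k%:R * #|Bt i :&: same_site i|%:R < eps * #|Bt i|%:R)
    #|Bt i|%:R `^ q <= eps / 4 * freq_moment p tau.
Proof.
move=> eps0; have k0 : 0 < k%:R :> R by rewrite ltr0n.
rewrite big_mkcond.
pose c (u : U) : R := #|[set i | tnth tau i == u]%SET|%:R.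
pose cj (u : U) (j : 'I_k) : R := #|[set i | (tnth tau i == u) && (place i == j)]%SET|%:R.
rewrite (partition_big (fun i => (tnth tau i, place i)) xpredT) //=.
rewrite -(pair_bigA _ (fun u j => \sum_(i | (tnth tau i, place i) == (u, j)) _)) /=.
rewrite /freq_moment mulr_sumr; apply: ler_sum => u _.
have -> : eps / 4 * c u `^ p = \sum_(j < k) eps / (4 * k%:R) * c u `^ p.
  by rewrite sumr_const card_ord -[RHS]mulr_natl; field; rewrite gt_eqF.
apply: ler_sum => j _.
rewrite (eq_bigr (fun=> if 4 * k%:R * cj u j < eps * c u then c u `^ q else 0)); last first.
  move=> i; rewrite xpair_eqE => /andP[/eqP <- /eqP <-].
  congr (if _ then _ else _); congr (_ * _%:R < _); apply: eq_card => i'.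
  by rewrite !inE.
rewrite sumr_const.
rewrite (_ : #|_| = #|[set i | (tnth tau i == u) && (place i == j)]%SET|); last first.
  by apply: eq_card => i; rewrite !inE.
rewrite -[leLHS]mulr_natl -/(cj u j); case: ifPn => [h|_]; last first.
  by rewrite mulr0 !mulr_ge0 ?invr_ge0 ?mulr_ge0 ?powR_ge0 ?ler0n.
rewrite -[X in _ <= _ * X]mulr_powRB1 ?ler0n //; last by move: p_ge2; lra.
rewrite mulrA ler_wpM2r ?powR_ge0 // -/(c u).
rewrite mulrAC ler_pdivlMr ?mulr_gt0 ?ltr0n // mulrC; exact: ltW.
Qed.

(** If the ball is more than twice as large as the class, the union alone makes the noise at least
    [t ^ (p - 1)]. Otherwise the site holds many class members but few ball members, so a fraction
    [eps / (8 k)] of the class lies outside the ball. *)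
Lemma noise_at_unkept (eps : R) i : 0 < eps < 1 -> ~~ kept eps i ->
  eps * #|Bt i|%:R <= 4 * k%:R * #|Bt i :&: same_site i|%:R ->
  #|Bt i|%:R `^ q <= (1 + 8 * k%:R / eps) * noise_at i.
Proof.
move=> /andP[eps0 eps1]; rewrite /kept -ltNge.
set b := #|B i|; set t := #|Bt i|; set o := #|B i :&: _|; set ot := #|Bt i :&: _|.
move=> unkept conc; have k1 : 1 <= k%:R :> R by rewrite ler1n.
have n0 := noise_at_ge0 i; have c0 : 0 <= 8 * k%:R / eps :> R.
  by rewrite divr_ge0 ?mulr_ge0 ?ler0n // ltW.
have [big|small] := ltP (2 * t%:R : R) b%:R.
  suff h : t%:R `^ q <= noise_at i.
    by rewrite mulrDl mul1r (le_trans h) // lerDl mulr_ge0.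
  rewrite lerBrDl; apply: (@le_trans _ _ (2 * t%:R `^ q)).
    by rewrite mulr_natl mulr2n lerD2r powR_card_le // finset.subsetIr.
  apply: (@le_trans _ _ ((2 * t%:R) `^ q)); first by apply: le1r_powRZ => //; lra.
  apply: (@le_trans _ _ (b%:R `^ q)); last by rewrite powR_card_le // finset.subsetUl.
  by apply: powR_le; rewrite ?mulr_ge0 // ltW.
(* With this [d], being unkept gives [o <= d * t], while concentration of the class gives
   [2 * d * t <= ot]. *)
pose d : R := eps / (8 * k%:R).
have d0 : 0 < d by rewrite divr_gt0 // mulr_gt0 ?ltr0n.
have d1 : d < 1 by rewrite ltr_pdivrMr ?mulr_gt0 ?ltr0n //; lra.
have edk : eps = 8 * k%:R * d by rewrite /d; field; rewrite pnatr_eq0 -lt0n.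
have kk0 : 0 < k%:R :> R by lra.
have t0 : 0 <= t%:R :> R by [].
have lost : #|B i :&: Bt i|%:R <= (1 - d) * t%:R.
  (* Split by site: elsewhere the intersection is within the class, and on the site it is within the
     ball. *)
  have cap : (#|B i :&: Bt i| + ot <= t + o)%N.
    rewrite /ot /t /o (finset.setIC (B i)) -(cardsID (same_site i) (Bt i :&: B i)).
    rewrite -(cardsID (same_site i) (Bt i)) [leqLHS]addnC -[leqRHS]addnA leq_add2l.
    rewrite [leqLHS]addnC leq_add // subset_leq_card //.
      by rewrite finset.setSD // finset.subsetIl.
    by rewrite finset.setSI // finset.subsetIr.
  have capR : #|B i :&: Bt i|%:R + ot%:R <= t%:R + o%:R :> R.
    by rewrite -!natrD ler_nat.
  have oR : o%:R <= d * t%:R.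
    rewrite -(ler_pM2l (mulr_gt0 (ltr0n R 16) kk0)).
    apply: ltW; apply: lt_le_trans unkept _.
    rewrite edk; have -> : 16 * k%:R * (d * t%:R) = 8 * k%:R * d * (2 * t%:R) by ring.
    by rewrite ler_wpM2l // !mulr_ge0 // ltW.
  have otR : 2 * d * t%:R <= ot%:R.
    rewrite -(ler_pM2l (mulr_gt0 (ltr0n R 4) kk0)); apply: le_trans conc.
    by rewrite edk le_eqVlt; apply/orP; left; apply/eqP; ring.
  lra.
have -> : 8 * k%:R / eps = d^-1 by rewrite /d invf_div.
suff h : d * t%:R `^ q <= noise_at i.
  rewrite mulrDl mul1r; apply: (@le_trans _ _ (d^-1 * noise_at i)); last by rewrite lerDr.
  by rewrite mulrC ler_pdivlMr // mulrC.
rewrite lerBrDl; apply: (@le_trans _ _ (t%:R `^ q)); last first.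
  by rewrite powR_card_le // finset.subsetUr.
suff : #|B i :&: Bt i|%:R `^ q <= (1 - d) * t%:R `^ q by lra.
apply: (@le_trans _ _ (((1 - d) * t%:R) `^ q)); first exact: powR_le.
(* A number in the unit interval only decreases under an exponent that is at least 1. *)
by apply: ge1r_powRZ => //; lra.
Qed.

(** Each item is charged to one of three sums: kept items up to their noise, scattered items, and
    unkept items paid for by [1 + 8 k / eps] times their noise. The bound on the noise level absorbs
    the large factor. *)
Lemma kept_moment_ge (eps : R) : 0 < eps < 1 ->
  noise_level p sim sigma tau <= eps `^ p / (4 `^ (p + 1) * k%:R `^ (p - 1)) ->
  (1 - eps / 2 - noise_level p sim sigma tau) * freq_moment p tau <=
  \sum_(i | kept eps i) #|B i|%:R `^ q.
Proof.
move=> heps small; have /andP[eps0 eps1] := heps.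
have k1 : 1 <= k%:R :> R by rewrite ler1n.
have F0 := freq_moment_ge0.
set eta := noise_level p sim sigma tau in small *.
set F := freq_moment p tau in F0 *.
have eta0 : 0 <= eta by exact: noise_level_ge0.
(* From [2 <= p]: [eps ^ p <= eps ^ 2], [64 <= 4 ^ (p + 1)] and [k <= k ^ (p - 1)]. *)
have key : 8 * k%:R / eps * eta <= eps / 8.
  rewrite mulrAC ler_pdivrMr //.
  apply: (@le_trans _ _ (8 * k%:R * (eps ^+ 2 / (64 * k%:R)))).
    rewrite ler_wpM2l // ?mulr_ge0 //; apply: le_trans small _.
    apply: ler_pM; rewrite ?powR_ge0 ?invr_ge0 ?mulr_ge0 ?powR_ge0 //.
      rewrite -[leRHS]powR_mulrn ?(ltW eps0) //.
      by apply: (ger_powR (a := eps)) p_ge2; rewrite eps0 ltW.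
    rewrite lef_pV2 ?posrE ?mulr_gt0 ?powR_gt0 //; try lra.
    apply: ler_pM => //.
      rewrite (_ : 64 = 4 ^+ 3 :> R); last by ring.
      rewrite -powR_mulrn //.
      by apply: ler_powR; move: p_ge2; lra.
    by apply: le1r_powR.
  rewrite le_eqVlt; apply/orP; left; apply/eqP; field.
  by rewrite pnatr_eq0 -lt0n.
have : F <= \sum_(i | kept eps i) #|B i|%:R `^ q + eps / 4 * F +
    (1 + 8 * k%:R / eps) * (eta * F).
  rewrite -sum_noise {1}/F freq_momentE.
  apply: le_trans (lerD (lerD (lexx _) (scattered_moment_le (ltW eps0))) (lexx _)).
  rewrite mulr_sumr [X in _ <= X + _ + _]big_mkcond [X in _ <= _ + X + _]big_mkcond /=.
  rewrite -!big_split /=.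
  apply: ler_sum => i _ /=; have n0 := noise_at_ge0 i.
  have c1 : 0 <= 8 * k%:R / eps * noise_at i.
    by rewrite mulr_ge0 // divr_ge0 ?mulr_ge0 // ltW.
  have cst0 : 0 <= (if 4 * k%:R * #|Bt i :&: same_site i|%:R < eps * #|Bt i|%:R
                    then #|Bt i|%:R `^ q else 0).
    by case: ifP => // _; exact: powR_ge0.
  case: ifPn => ki.
    have : #|Bt i|%:R `^ q <= #|B i|%:R `^ q + noise_at i.
      rewrite /noise_at addrCA -[leLHS]addr0 lerD ?powR_card_le ?finset.subsetUr //.
      by rewrite subr_ge0 powR_card_le // finset.subsetIl.
    move=> h; apply: le_trans h _; rewrite -addrA lerD2l.
    by rewrite [(1 + _) * noise_at i]mulrDl mul1r addrCA lerDl addr_ge0.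
  rewrite add0r; case: ltP => h; last by rewrite add0r noise_at_unkept.
  by rewrite lerDl mulr_ge0 // addr_ge0 // divr_ge0 ?mulr_ge0 // ltW.
have : 8 * k%:R / eps * (eta * F) <= eps / 8 * F by rewrite mulrA ler_wpM2r.
(* The losses [eps / 4] and [eps / 8] fit into [eps / 2]. *)
nra.
Qed.

End Noise.

(** * Accuracy of the estimate *)

Section Masses.
Variables (R : realType) (p : R).
Hypothesis p_ge2 : 2 <= p.
Implicit Type o : seq (seq bool).

Local Notation q := (p - 1).
Let p_gt0 : 0 < p. Proof. by move: p_ge2; lra. Qed.
Let q_ge0 : 0 <= q. Proof. by move: p_ge2; lra. Qed.
Let q_neq0 : q != 0. Proof. by rewrite gt_eqF //; move: p_ge2; lra. Qed.

Lemma local_moment_ge0 o : 0 <= local_moment p o.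
Proof. by apply: sumr_ge0 => h _; exact: powR_ge0. Qed.

(** A nonzero term has degree at least 1. Hence a nonzero moment has a root of integer part at least
    1, as rounding by a factor 2 requires. *)
Lemma local_moment_ge1 o : local_moment p o != 0 -> 1 <= local_moment p o.
Proof.
move=> G0; have [h h0] : exists h : 'I_(size o), (0 < row_degree o h)%N.
  apply/existsP; apply: contraNT G0 => /existsPn none; apply/eqP.
  apply: big1 => h _; move: (none h); rewrite -leqNgt leqn0 => /eqP ->.
  exact: powR0.
rewrite /local_moment (bigD1 h) //= -[leLHS]addr0 lerD ?sumr_ge0 //.
by rewrite -[leLHS](powRr0 (row_degree o h)%:R) ler_powR // ler1n.
Qed.

Lemma mass_ge0 N : 0 <= mass p N.
Proof. exact: powR_ge0. Qed.

Lemma root_momentK o : (local_moment p o `^ p^-1) `^ p = local_moment p o.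
Proof.
by rewrite -powRrM mulVf ?gt_eqF // powRr1 // local_moment_ge0.
Qed.

(** For a root [x >= 1] with integer part [N], one has [x < N + 1 <= 2 N]. *)
Lemma le_mass o : local_moment p o <= mass p (root_moment p o).
Proof.
have [G0|/local_moment_ge1 G1] := eqVneq (local_moment p o) 0.
  by rewrite G0 mass_ge0.
rewrite -{1}root_momentK /mass; set x := _ `^ p^-1.
have x1 : 1 <= x by rewrite -[leLHS](powRr0 (local_moment p o)) ler_powR // invr_ge0 ltW.
have x0 : 0 <= x by exact: powR_ge0.
apply: ge0_ler_powR; rewrite ?nnegrE ?mulr_ge0 ?(ltW p_gt0) //.
have := truncn_itv x0; rewrite /root_moment -/x => /andP[_]; rewrite -natr1.
have : 1 <= (Num.truncn x)%:R :> R by rewrite ler1n truncn_gt0.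
lra.
Qed.

Lemma mass_le o : mass p (root_moment p o) <= 2 `^ p * local_moment p o.
Proof.
rewrite -root_momentK -powRM // ?powR_ge0 //.
apply: ge0_ler_powR; rewrite ?nnegrE ?mulr_ge0 ?powR_ge0 ?(ltW p_gt0) //.
by rewrite ler_pM2l // truncn_le powR_ge0.
Qed.

(** With [s] items of degree at most [s], the moment is at most [s ^ p]; so the announced number
    fits in a word. *)
Lemma root_moment_le o : (forall h, row_degree o h <= size o)%N ->
  (root_moment p o <= size o)%N.
Proof.
move=> deg; rewrite -(ler_nat R).
apply: (@le_trans _ _ (local_moment p o `^ p^-1)).
  by rewrite truncn_le powR_ge0.
rewrite -[leRHS]powRr1 // -[X in _ <= _ `^ X](mulfV (x := p)) ?gt_eqF // powRrM.
apply: ge0_ler_powR; rewrite ?nnegrE ?invr_ge0 ?powR_ge0 ?local_moment_ge0 ?(ltW p_gt0) //.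
rewrite -mulr_powRB1 // -[X in X%:R * _](card_ord (size o)) mulr_natl -sumr_const.
by apply: ler_sum => h _; apply: ge0_ler_powR; rewrite ?nnegrE // ler_nat.
Qed.

(** By [le_mass] the weights sum to at most 1, so clipping is void; the hypothesis on [f] removes
    the index that takes the missing weight. *)
Lemma expect_draw o f : f (size o) = 0 ->
  expect (draw_index (sampling_weights p o)) f =
  \sum_(h < size o) (row_degree o h)%:R `^ q / mass p (root_moment p o) * f h.
Proof.
move=> f0; rewrite /expect -[outcomes _]/(index_outcomes _) /index_outcomes.
have -> : clipped (sampling_weights p o) = sampling_weights p o.
  rewrite /clipped ifT //; apply/andP; split.
    rewrite all_map; apply/allP => h _ /=.
    by rewrite mulr_ge0 ?powR_ge0 // invr_ge0 mass_ge0.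
  rewrite big_map -mulr_suml -{1}(subn0 (size o)) big_mkord -/(local_moment p o).
  have [->|M0] := eqVneq (mass p (root_moment p o)) 0; first by rewrite invr0 mulr0.
  by rewrite ler_pdivrMr ?mul1r ?le_mass // lt_neqAle eq_sym M0 mass_ge0.
rewrite big_cons size_map size_iota f0 mulr0 add0r big_map /=.
rewrite -{1}(subn0 (size o)) big_mkord; apply: eq_bigr => h _.
by rewrite (nth_map 0%N) ?size_iota // nth_iota.
Qed.

End Masses.

(** * Mean and variance of the estimate *)

Section Estimate.
Variables (R : realType) (p : R) (k : nat) (eps : R).
Hypothesis p_ge2 : 2 <= p.
Hypothesis k_gt0 : (0 < k)%N.
Hypothesis eps_gt0 : 0 < eps.
Variables (T : Type) (sim : rel T) (m : nat) (sigma : m.-tuple T).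
Variable place : 'I_m -> 'I_k.
Hypothesis sim_refl : reflexive sim.
Hypothesis sim_sym : symmetric sim.

Local Notation q := (p - 1).
Local Notation items := (site_items sigma place).
Local Notation root := (site_root p sim sigma place).
Local Notation B := (ball_noisy sim sigma).
Local Notation own i := #|B i :&: same_site place i|.
Local Notation ndraws := (site_draws p eps sim sigma place).
Local Notation oracle_at := (site_oracle sim sigma place).
Local Notation gain_at := (gain p eps sim sigma place).

Let q_ge0 : 0 <= q. Proof. by move: p_ge2; lra. Qed.

Lemma sum_onth (S : Type) (s : seq S) (psi : S -> R) :
  \sum_(h < size s) (if onth s h is Some x then psi x else 0) =
  \sum_(x <- s) psi x.
Proof.
elim: s => [|x s IH]; first by rewrite big_ord0 big_nil.
by rewrite big_cons big_ord_recl /= -IH.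
Qed.

Lemma sum_site_items j (psi : T -> R) :
  \sum_(x <- items j) psi x = \sum_(i | place i == j) psi (tnth sigma i).
Proof. by rewrite big_map big_filter big_enum_cond; apply: eq_bigl. Qed.

Lemma size_site_oracle j : size (oracle_at j) = size (items j).
Proof. by rewrite size_map. Qed.

Lemma size_site_items_le j : (size (items j) <= m)%N.
Proof.
by rewrite size_map size_filter -[leqRHS]card_ord cardE count_size.
Qed.

Lemma row_degree_site j h x : onth (items j) h = Some x ->
  row_degree (oracle_at j) h = site_count sim sigma place j x.
Proof.
by move=> hx; rewrite /row_degree /site_oracle (onth_map_nth _ _ hx) count_map.
Qed.

Lemma row_degree_le j h : (row_degree (oracle_at j) h <= size (oracle_at j))%N.
Proof.
rewrite /row_degree; have [lt|ge] := ltnP h (size (oracle_at j)); last first.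
  by rewrite nth_default.
apply: leq_trans (count_size _ _) _.
have : all (fun r => size r == size (oracle_at j)) (oracle_at j).
  rewrite size_site_oracle all_map (eq_all (a2 := xpredT)) ?all_predT // => x /=.
  by rewrite size_map eqxx.
by move=> /all_nthP -/(_ [::] h lt) /eqP ->.
Qed.

Lemma site_count_card j i :
  site_count sim sigma place j (tnth sigma i) = #|B i :&: [set l | place l == j]%SET|.
Proof.
rewrite /site_count count_map count_filter -sum1_count -sum1_card big_enum_cond.
(* Symmetry is needed because counts and balls take the arguments of [sim] in opposite orders. *)
by apply: eq_bigl => l; rewrite !inE /= sim_sym.
Qed.

Lemma site_count_own i : site_count sim sigma place (place i) (tnth sigma i) = own i.
Proof. exact: site_count_card. Qed.

Lemma sum_site_count i :
  (\sum_j site_count sim sigma place j (tnth sigma i))%N = #|B i|.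
Proof.
rewrite -sum1_card (partition_big place xpredT) //=; apply: eq_bigr => j _.
by rewrite site_count_card -sum1_card; apply: eq_bigl => l; rewrite !inE.
Qed.

Lemma own_gt0 i : (0 < own i)%N.
Proof. by apply/card_gt0P; exists i; rewrite !inE sim_refl eqxx. Qed.

Lemma sum_site_oracle j (psi : T -> R) :
  \sum_(h < size (oracle_at j))
     (if onth (items j) h is Some x then psi x else 0) =
  \sum_(i | place i == j) psi (tnth sigma i).
Proof. by rewrite size_site_oracle sum_onth sum_site_items. Qed.

Lemma onth_ltn (S : Type) (s : seq S) h : (h < size s)%N -> exists x, onth s h = Some x.
Proof. by elim: s h => // x s IH [|h] /=; [exists x | exact: IH]. Qed.

Lemma onth_oversize (S : Type) (s : seq S) h : (size s <= h)%N -> onth s h = None.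
Proof. by elim: s h => [[]|x s IH [|h]] //=; exact: IH. Qed.

Lemma onth_site j h : (h < size (oracle_at j))%N -> exists x, onth (items j) h = Some x.
Proof. by rewrite size_site_oracle; exact: onth_ltn. Qed.

Lemma local_moment_site j :
  local_moment p (oracle_at j) = \sum_(i | place i == j) (own i)%:R `^ q.
Proof.
transitivity (\sum_(i | place i == j)
    (site_count sim sigma place j (tnth sigma i))%:R `^ q : R).
  rewrite -(sum_site_oracle j (fun x => (site_count sim sigma place j x)%:R `^ q)).
  apply: eq_bigr => h _; have [x hx] := onth_site (ltn_ord h).
  by rewrite hx (row_degree_site hx).
by apply: eq_bigr => i /eqP <-; rewrite site_count_own.
Qed.

Lemma mass_site_gt0 i : 0 < mass p (root (place i)).
Proof.
apply: lt_le_trans (le_mass p_ge2 (oracle_at (place i))).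
rewrite local_moment_site (bigD1 i) //= ltr_wpDr //.
  by apply: sumr_ge0 => l _; exact: powR_ge0.
by rewrite powR_gt0 // ltr0n own_gt0.
Qed.

Let pow_own i : rescaled p k eps (own i) #|B i| * (own i)%:R `^ q =
  if kept sim sigma place eps i then #|B i|%:R `^ q else 0.
Proof.
rewrite /rescaled -/(kept sim sigma place eps i); case: ifP => _; last exact: mul0r.
rewrite -powRM ?divr_ge0 // divfK // pnatr_eq0 -lt0n; exact: own_gt0.
Qed.

(** One factor cancels the sampling weight as in [pow_own]; the cutoff bounds the other. *)
Let pow_own2 i : rescaled p k eps (own i) #|B i| ^+ 2 * (own i)%:R `^ q <=
  (16 * k%:R / eps) `^ q * #|B i|%:R `^ q.
Proof.
rewrite expr2 -mulrA pow_own; rewrite /rescaled -/(kept sim sigma place eps i).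
case: ifP => ki; last by rewrite mul0r mulr_ge0 ?powR_ge0.
have o0 : 0 < (own i)%:R :> R by rewrite ltr0n own_gt0.
rewrite ler_wpM2r ?powR_ge0 //.
apply: ge0_ler_powR; rewrite ?nnegrE ?divr_ge0 ?mulr_ge0 ?(ltW eps_gt0) //.
rewrite ler_pdivrMr // mulrAC ler_pdivlMr // mulrC; exact: ki.
Qed.

(** Stated for any [phi] vanishing at 0, to serve both the mean ([id]) and the second moment (the
    square). *)
Lemma expect_draw_gain j (phi : R -> R) : phi 0 = 0 ->
  expect (draw_index (sampling_weights p (oracle_at j)))
    (fun h => phi (gain_at j (WItem h))) =
  \sum_(i | place i == j) (own i)%:R `^ q / mass p (root j) *
    phi (mass p (root j) / (ndraws j)%:R * rescaled p k eps (own i) #|B i|).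
Proof.
move=> phi0; rewrite expect_draw //; last first.
  by rewrite /gain onth_oversize // size_site_oracle.
pose psi x := (site_count sim sigma place j x)%:R `^ q / mass p (root j) *
   phi (mass p (root j) / (ndraws j)%:R *
     rescaled p k eps (site_count sim sigma place j x)
       (\sum_i site_count sim sigma place i x)%N).
transitivity (\sum_(i | place i == j) psi (tnth sigma i)); last first.
  by apply: eq_bigr => i /eqP e; rewrite /psi sum_site_count -e site_count_own.
rewrite -sum_site_oracle; apply: eq_bigr => h _; have [x hx] := onth_site (ltn_ord h).
by rewrite /gain hx (row_degree_site hx).
Qed.

Lemma expect_site_sample o n (f : message -> R) :
  expect (site_sample p o n) f =
  expect (dtuple (fun _ : 'I_n => draw_index (sampling_weights p o)))
    (fun t => f (map WItem t)).
Proof. by rewrite expect_dbind; apply: eq_expect => t; rewrite expect_dret. Qed.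

Lemma sum_message n (t : n.-tuple nat) (g : word -> R) :
  \sum_(w <- map WItem t) g w = \sum_(i < n) g (WItem (tnth t i)).
Proof. by rewrite big_map big_tuple. Qed.

Lemma ndraws_gt0 j : 0 < (ndraws j)%:R :> R.
Proof. by rewrite ltr0n. Qed.

(** The number of draws, the mass and the power of [own] all cancel, so the estimate is biased only
    by the items that are not kept. *)
Lemma expect_site_gain j :
  expect (site_sample p (oracle_at j) (ndraws j))
    (fun msg => \sum_(w <- msg) gain_at j w) =
  \sum_(i | (place i == j) && kept sim sigma place eps i) #|B i|%:R `^ q.
Proof.
rewrite expect_site_sample; under eq_expect do rewrite sum_message.
rewrite (expect_dtuple_sum _ (fun _ h => gain_at j (WItem h))).
rewrite sumr_const card_ord (expect_draw_gain _ (phi := id)) //.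
rewrite -[LHS]mulr_natl mulr_sumr big_mkcondr; apply: eq_bigr => i /eqP <-.
rewrite -pow_own; have M0 := mass_site_gt0 i; have n0 := ndraws_gt0 (place i).
by field; rewrite !gt_eqF.
Qed.

Lemma variance_site_gain j :
  variance_of (site_sample p (oracle_at j) (ndraws j))
    (fun msg => \sum_(w <- msg) gain_at j w) <=
  mass p (root j) / (ndraws j)%:R * ((16 * k%:R / eps) `^ q *
  \sum_(i | place i == j) #|B i|%:R `^ q).
Proof.
set g := fun msg => _.
have -> : variance_of (site_sample p (oracle_at j) (ndraws j)) g =
    variance_of (dtuple (fun _ : 'I_(ndraws j) => draw_index (sampling_weights p (oracle_at j))))
      (fun t => \sum_i gain_at j (WItem (tnth t i))).
  rewrite /variance_of !expect_site_sample /g.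
  have e : expect (dtuple (fun _ : 'I_(ndraws j) => draw_index (sampling_weights p (oracle_at j))))
      (fun t => \sum_(w <- map WItem t) gain_at j w) =
    expect (dtuple (fun _ : 'I_(ndraws j) => draw_index (sampling_weights p (oracle_at j))))
      (fun t => \sum_i gain_at j (WItem (tnth t i))).
    by apply: eq_expect => t; rewrite sum_message.
  by rewrite e; apply: eq_expect => t; rewrite sum_message.
rewrite (variance_dtuple_sum _ (fun _ h => gain_at j (WItem h))).
rewrite sumr_const card_ord -[leLHS]mulr_natl.
apply: (@le_trans _ _ ((ndraws j)%:R *
    expect (draw_index (sampling_weights p (oracle_at j)))
      (fun h => gain_at j (WItem h) ^+ 2))).
  by rewrite ler_wpM2l // variance_of_le.
rewrite (expect_draw_gain _ (phi := fun x => x ^+ 2)) ?expr0n //.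
rewrite !mulr_sumr; apply: ler_sum => i /eqP <-.
have M0 := mass_site_gt0 i; have n0 := ndraws_gt0 (place i).
apply: (@le_trans _ _ (mass p (root (place i)) / (ndraws (place i))%:R *
  (rescaled p k eps (own i) #|B i| ^+ 2 * (own i)%:R `^ q))).
  by rewrite le_eqVlt; apply/orP; left; apply/eqP; field; rewrite !gt_eqF.
by rewrite ler_wpM2l ?pow_own2 // divr_ge0 // ltW.
Qed.

Let n_gt0 : 0 < sample_size p k eps.
Proof.
by rewrite /sample_size divr_gt0 ?mulr_gt0 ?powR_gt0 ?ltr0n.
Qed.

(** Draws are shared out in proportion to mass and rounded up, so no draw stands for more than its
    fair part of the total mass. *)
Lemma mass_per_draw_le j :
  mass p (root j) / (ndraws j)%:R <= (\sum_i mass p (root i)) / sample_size p k eps.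
Proof.
set M := \sum_i _; have Mj : mass p (root j) <= M.
  by rewrite /M (bigD1 j) //= lerDl sumr_ge0 // => i _; exact: mass_ge0.
have M0 : 0 <= M by apply: le_trans Mj; exact: mass_ge0.
move: M0; rewrite le_eqVlt => /predU1P[M0|M0].
  have -> : mass p (root j) = 0.
    by apply/eqP; rewrite eq_le mass_ge0 andbT M0.
  by rewrite mul0r -M0 mul0r.
rewrite ler_pdivlMr // mulrAC ler_pdivrMr ?ndraws_gt0 //.
rewrite [leLHS]mulrC [leRHS]mulrC -ler_pdivrMr //.
by rewrite ltW // /site_draws /draws -/M truncnS_gt.
Qed.

Lemma expect_estimate :
  expect (dtuple (fun j => site_sample p (oracle_at j) (ndraws j)))
    (fun rep => \sum_j \sum_(w <- tnth rep j) gain_at j w) =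
  \sum_(i | kept sim sigma place eps i) #|B i|%:R `^ q.
Proof.
rewrite (expect_dtuple_sum _ (fun j msg => \sum_(w <- msg) gain_at j w)).
rewrite [RHS](partition_big place xpredT) //=; apply: eq_bigr => j _.
by rewrite expect_site_gain; apply: eq_bigl => i; rewrite andbC.
Qed.

(** Since each [own] count is at most the ball size, the total mass is at most [2 ^ p * S];
    [sample_size] then cancels all remaining factors. *)
Lemma variance_estimate :
  variance_of (dtuple (fun j => site_sample p (oracle_at j) (ndraws j)))
    (fun rep => \sum_j \sum_(w <- tnth rep j) gain_at j w) <=
  eps ^+ 2 / 1600 * (\sum_i #|B i|%:R `^ q) ^+ 2.
Proof.
rewrite (variance_dtuple_sum _ (fun j msg => \sum_(w <- msg) gain_at j w)).
set S := \sum_i #|B i|%:R `^ q.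
set M := \sum_j mass p (root j).
have S0 : 0 <= S by apply: sumr_ge0 => i _; exact: powR_ge0.
apply: (@le_trans _ _ (M / sample_size p k eps * ((16 * k%:R / eps) `^ q * S))).
  rewrite {1}/S (partition_big place xpredT) //= !mulr_sumr; apply: ler_sum => j _.
  apply: le_trans (variance_site_gain j) _; apply: ler_wpM2r (mass_per_draw_le j).
  by rewrite mulr_ge0 ?powR_ge0 ?sumr_ge0 // => i _; exact: powR_ge0.
have MS : M <= 2 `^ p * S.
  apply: (@le_trans _ _ (\sum_j 2 `^ p * local_moment p (oracle_at j))).
    by apply: ler_sum => j _; exact: mass_le.
  rewrite -mulr_sumr ler_wpM2l ?powR_ge0 // /S (partition_big place xpredT) //=.
  apply: ler_sum => j _; rewrite local_moment_site; apply: ler_sum => i _.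
  apply: ge0_ler_powR; rewrite ?nnegrE // ler_nat subset_leq_card //.
  exact: finset.subsetIl.
have -> : M / sample_size p k eps * ((16 * k%:R / eps) `^ q * S) =
    M / 2 `^ p * S * (eps ^+ 2 / 1600).
  have k0 : 0 < k%:R :> R by rewrite ltr0n.
  rewrite /sample_size powRM ?invr_ge0 ?mulr_ge0 ?(ltW eps_gt0) // powRM //.
  have -> : eps^-1 `^ q = (eps `^ q)^-1.
    by rewrite -(powR_inv1 (ltW eps_gt0)) -powRrM mulN1r powRN.
  have -> : eps `^ (p + 1) = eps `^ q * eps ^+ 2.
    rewrite -powR_mulrn ?(ltW eps_gt0) // -powRD ?(gt_eqF eps_gt0) ?implybT //.
    by congr powR; ring.
  have a0 : 2 `^ p != 0 :> R by rewrite gt_eqF ?powR_gt0.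
  have b0 : 16 `^ q != 0 :> R by rewrite gt_eqF ?powR_gt0.
  have c0 : k%:R `^ q != 0 :> R by rewrite gt_eqF ?powR_gt0.
  have d0 : eps `^ q != 0 :> R by rewrite gt_eqF ?powR_gt0.
  have e0 : eps != 0 by rewrite gt_eqF.
  by field; rewrite a0 b0 c0 d0 e0.
rewrite [leLHS]mulrC; apply: ler_wpM2l.
  by apply: mulr_ge0; [exact: sqr_ge0 | rewrite invr_ge0 ler0n].
rewrite [leRHS]expr2; apply: ler_wpM2r => //.
by rewrite ler_pdivrMr ?powR_gt0 // mulrC.
Qed.

End Estimate.

(** * Communication *)

Section Communication.
Variables (R : realType) (p : R) (k : nat) (eps : R).
Hypothesis p_ge2 : 2 <= p.
Hypothesis k_gt0 : (0 < k)%N.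
Hypothesis eps_gt0 : 0 < eps.
Hypothesis eps_lt1 : eps < 1.
Variables (T : Type) (sim : rel T) (m : nat) (sigma : m.-tuple T).
Variable place : 'I_m -> 'I_k.

Local Notation total := (total_traffic p eps sim sigma place).
Local Notation ndraws := (site_draws p eps sim sigma place).

Lemma all_flatten_map (I S : Type) (a : pred S) (F : I -> seq S) s :
  (forall i, all a (F i)) -> all a (flatten [seq F i | i <- s]).
Proof. by move=> H; elim: s => //= i s IH; rewrite all_cat H. Qed.

Lemma size_flatten_ord_map (S : Type) (F : 'I_k -> seq S) :
  size (flatten [seq F j | j <- enum 'I_k]) = (\sum_j size (F j))%N.
Proof. by rewrite size_flatten /shape -map_comp sumnE big_map big_enum. Qed.

Lemma total_traffic_fits rep : fits_words m (total rep).
Proof.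
rewrite /fits_words /total_traffic !(all_cat, map_cat) !all_map.
rewrite -andbA; apply/and5P; split.
- rewrite (eq_all (a2 := xpredT)) ?all_predT // => j /=.
  apply: leq_trans (size_site_items_le sigma place j).
  rewrite -(size_site_oracle sim); apply: root_moment_le => // h.
  exact: row_degree_le.
- by apply: all_flatten_map => j; rewrite all_nseq orbT.
- exact: all_predT.
- by apply: all_flatten_map => j; rewrite all_map; exact: all_predT.
- apply: all_flatten_map => j; rewrite !all_map.
  rewrite (eq_all (a2 := xpredT)) ?all_predT // => x /=.
  exact: leq_trans (count_size _ _) (size_site_items_le _ _ _).
Qed.

Lemma size_total_traffic rep :
  size (total rep) =
  (k + \sum_j ndraws j + (1 + k + k) * size (samples sigma place rep))%N.
Proof.
rewrite /total_traffic; move: (samples sigma place rep) => s.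
rewrite 3!size_cat size_map size_cat size_ord_map size_map !size_flatten_ord_map.
rewrite (eq_bigr ndraws) => [|j _]; last by rewrite size_nseq.
rewrite [X in (_ + (_ + (X + _)))%N](eq_bigr (fun=> size s)) => [|j _];
  last by rewrite size_map.
rewrite [X in (_ + (_ + (_ + X)))%N](eq_bigr (fun=> size s)) => [|j _].
  by rewrite sum_nat_const card_ord !mulnDl mul1n !addnA.
by rewrite !size_map.
Qed.

Lemma size_samples_le rep : (forall j, size (tnth rep j) = ndraws j) ->
  (size (samples sigma place rep) <= \sum_j ndraws j)%N.
Proof.
move=> sz; rewrite size_flatten_ord_map; apply: leq_sum => j _.
by rewrite -sz size_pmap count_size.
Qed.

(** Rounding up costs at most one draw per site. *)
Lemma sum_draws_le (N : 'I_k -> nat) :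
  (\sum_j draws p eps N j)%:R <= sample_size p k eps + k%:R.
Proof.
rewrite natr_sum; set n := sample_size p k eps.
have n0 : 0 <= n by rewrite /n /sample_size divr_ge0 ?mulr_ge0 ?powR_ge0 ?ler0n.
have m0 j : 0 <= mass p (N j) by exact: powR_ge0.
apply: (@le_trans _ _ (\sum_j (n * mass p (N j) / (\sum_i mass p (N i)) + 1))).
  apply: ler_sum => j _; rewrite -natr1 lerD2r truncn_le.
  by apply: divr_ge0; [exact: mulr_ge0 n0 (m0 j) | exact: sumr_ge0].
rewrite big_split /= sumr_const card_ord lerD2r -mulr_suml -mulr_sumr.
have [->|M0] := eqVneq (\sum_i mass p (N i)) 0; first by rewrite mulr0 mul0r.
by rewrite mulfK.
Qed.

(** With [d] draws the traffic is at most [k + 4 k d]. Both [k] and [k ^ 2] are at most [x], as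
    [2 <= p], and [k] times the sample size is [1600 c x]; this gives [5 + 6400 c]. *)
Lemma size_traffic_le rep : (forall j, size (tnth rep j) = ndraws j) ->
  (size (total rep))%:R <=
  (5 + 6400 * 2 `^ p * 16 `^ (p - 1)) * (k%:R `^ p / eps `^ (p + 1)).
Proof.
move=> sz; have k1 : 1 <= k%:R :> R by rewrite ler1n.
have e0 : 0 < eps `^ (p + 1) by exact: powR_gt0.
set c : R := 2 `^ p * 16 `^ (p - 1).
have c0 : 0 <= c by rewrite mulr_ge0 ?powR_ge0.
set x := k%:R `^ p / eps `^ (p + 1).
have kk : k%:R ^+ 2 <= x.
  rewrite -powR_mulrn //; apply: (@le_trans _ _ (k%:R `^ p)).
    exact: ler_powR.
  rewrite ler_pdivlMr // ler_piMr ?powR_ge0 //.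
  rewrite -[leRHS](powRr0 eps); apply: (ger_powR (a := eps)).
    by rewrite eps_gt0 ltW.
  by move: p_ge2; lra.
have nE : k%:R * sample_size p k eps = 1600 * c * x.
  rewrite /sample_size /x -(mulr_powRB1 (x := k%:R) (p := p)) ?ler0n //.
    by rewrite /c; field; rewrite gt_eqF.
  by move: p_ge2; lra.
have D := sum_draws_le (site_root p sim sigma place).
have s : (size (samples sigma place rep))%:R <= (\sum_j ndraws j)%:R :> R.
  by rewrite ler_nat size_samples_le.
rewrite size_total_traffic natrD natrM !natrD.
set d : R := (\sum_j ndraws j)%:R in D s *.
have D' : d <= sample_size p k eps + k%:R by exact: D.
apply: (@le_trans _ _ (k%:R + d + (1 + k%:R + k%:R) * d)).
  by rewrite lerD2l ler_wpM2l // !addr_ge0.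
have d0 : 0 <= d by rewrite ler0n.
have : k%:R * d <= k%:R * (sample_size p k eps + k%:R) by rewrite ler_wpM2l.
rewrite mulrDr nE -expr2 => kd.
have dk : d <= k%:R * d by rewrite ler_peMl.
have k2 : k%:R <= k%:R ^+ 2 :> R by rewrite expr2 ler_peMr.
rewrite -mulrA -/c; nra.
Qed.

Lemma prob_communication :
  prob (execution sim (sampling_protocol p k eps) 3 sigma place)
    (fun o => fits_words m o.1 &&
       ((size o.1)%:R <= (5 + 6400 * 2 `^ p * 16 `^ (p - 1)) *
                         (k%:R `^ p / eps `^ (p + 1)))) = 1.
Proof.
rewrite probE expect_execution //=.
rewrite (expect_on (g := fun=> 1)
  (surely_dtuple (fun j => surely_site_sample _ _ _))) ?expect_cst //.
move=> rep /forallP H; rewrite total_traffic_fits size_traffic_le // => j.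
by have /andP[_ /eqP] := H j.
Qed.

End Communication.

(** * Concentration of the output and conclusion *)

Lemma le_prob (R : realType) (A : Type) (d : dist R A) (E F : A -> bool) :
  (forall a, E a -> F a) -> prob d E <= prob d F.
Proof.
move=> EF; rewrite !probE; apply: le_expect => a.
by case: (boolP (E a)) => [/EF ->|_].
Qed.

(** Forces the noise level below 1, so that the noisy moment is at most twice the true one. *)
Lemma noise_bound_le1 (R : realType) (p eps : R) k : 2 <= p -> (0 < k)%N ->
  0 < eps < 1 -> eps `^ p / (4 `^ (p + 1) * k%:R `^ (p - 1)) <= 1.
Proof.
move=> p2 k0 /andP[e0 e1].
rewrite ler_pdivrMr ?mul1r ?mulr_gt0 ?powR_gt0 ?ltr0n //.
apply: (@le_trans _ _ 1).
  rewrite -[leRHS](powRr0 eps); apply: (ger_powR (a := eps)); last by lra.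
  by rewrite e0 ltW.
rewrite -[leLHS]mulr1; apply: ler_pM => //.
  by rewrite -[leLHS](powRr0 4); apply: ler_powR; lra.
by rewrite -[leLHS](powRr0 k%:R); apply: ler_powR; rewrite ?ler1n //; lra.
Qed.

(** The mean is off by at most [eps / 2 + eta] below and [eta] above, relative to the moment;
    Chebyshev adds a deviation of [eps / 2]. *)
Lemma prob_accuracy (R : realType) (p : R) (hp : 2 <= p) k (eps : R)
    (k0 : (0 < k)%N) (heps : 0 < eps < 1) (T : Type) (sim : rel T)
    (sim_refl : reflexive sim) (sim_sym : symmetric sim) m (sigma : m.-tuple T)
    (place : 'I_m -> 'I_k) (U : finType) (tau : m.-tuple U) :
  noise_level p sim sigma tau <= eps `^ p / (4 `^ (p + 1) * k%:R `^ (p - 1)) ->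
  99 / 100 <=
  prob (execution sim (sampling_protocol p k eps) 3 sigma place)
    (fun o =>
       (1 - eps - noise_level p sim sigma tau) * freq_moment p tau <= o.2
         <= (1 + eps + noise_level p sim sigma tau) * freq_moment p tau).
Proof.
move=> small; have /andP[e0 e1] := heps.
have ge := kept_moment_ge hp place k0 heps small.
have le := noisy_moment_le hp sim sigma tau.
have eta1 := le_trans small (noise_bound_le1 hp k0 heps).
have F0 := freq_moment_ge0 p tau; have eta0 := noise_level_ge0 hp sim sigma tau.
have var := variance_estimate hp k0 e0 sigma place sim_refl sim_sym.
have mean := expect_estimate eps hp sigma place sim_refl sim_sym.
rewrite probE expect_execution // -probE.
set eta := noise_level _ _ _ _ in ge le eta1 eta0 *.
set F := freq_moment p tau in ge le F0 *.
set S := \sum_i _ in le var.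
set Y := \sum_(i | _) _ in ge mean.
have YS : Y <= S.
  rewrite /Y /S big_mkcond; apply: ler_sum => i _.
  by case: ifP => // _; exact: powR_ge0.
have S0 : 0 <= S by apply: sumr_ge0 => i _; exact: powR_ge0.
have S2 : S <= 2 * F by apply: le_trans le _; rewrite ler_wpM2r //; lra.
have a0 : 0 <= eps * F / 2 by rewrite divr_ge0 // mulr_ge0 // ltW.
have c0 : 0 <= 1 / 100 :> R by rewrite divr_ge0 ?ler0n.
have : variance_of (dtuple (fun j => site_sample p (site_oracle sim sigma place j)
    (site_draws p eps sim sigma place j)))
    (fun rep => \sum_j \sum_(w <- tnth rep j) gain p eps sim sigma place j w) <=
    1 / 100 * (eps * F / 2) ^+ 2.
  apply: le_trans var _.
  have -> : 1 / 100 * (eps * F / 2) ^+ 2 = eps ^+ 2 / 1600 * (2 * F) ^+ 2 by field.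
  apply: ler_wpM2l.
    by apply: mulr_ge0; [exact: sqr_ge0 | rewrite invr_ge0 ler0n].
  by apply: lerXn2r; rewrite ?nnegrE ?mulr_ge0.
move=> /(chebyshev_dist a0 c0); rewrite mean.
have -> : 1 - 1 / 100 = 99 / 100 :> R by field.
move=> h; apply: le_trans h _; apply: le_prob => rep /=.
rewrite ler_distl => /andP[lo hi]; apply/andP; split; nra.
Qed.

Theorem theorem5 (R : realType) (p : R) (hp : 2 <= p) :
  exists (C K : R) (A : forall k : nat, R -> protocol R k),
  forall (k : nat) (eps : R), (0 < k)%N -> 0 < eps < 1 ->
  forall (T : Type) (sim : rel T), reflexive sim -> symmetric sim ->
  forall (m : nat) (sigma : m.-tuple T) (place : 'I_m -> 'I_k),
  prob (execution sim (A k eps) 3 sigma place)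
    (fun o => fits_words m o.1 &&
       ((size o.1)%:R <= K * (k%:R `^ p / eps `^ (p + 1)))) = 1 /\
  forall (U : finType) (tau : m.-tuple U),
  noise_level p sim sigma tau <= eps `^ p / (4 `^ (p + 1) * k%:R `^ (p - 1)) ->
  99 / 100 <=
  prob (execution sim (A k eps) 3 sigma place)
    (fun o =>
       (1 - eps - C * noise_level p sim sigma tau) * freq_moment p tau <= o.2
         <= (1 + eps + C * noise_level p sim sigma tau) * freq_moment p tau).
Proof.
(* The noise enters both bounds on the mean with factor 1, whence [C = 1]. *)
exists 1, (5 + 6400 * 2 `^ p * 16 `^ (p - 1)), (sampling_protocol p).
move=> k eps k0 heps T sim sim_refl sim_sym m sigma place; have /andP[e0 e1] := heps.
split=> [|U tau small]; first exact: prob_communication.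
by rewrite mul1r; exact: prob_accuracy.
Qed.
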